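(* Let $\widetilde M(c)$ be a Kaehler-like statistical manifold of constant holomorphic sectional curvature $c$, and let $(M,g)$ be a Hopf hypersurface of $\widetilde M(c)$ satisfying $\nabla_X\varphi=0$ for any $X\in\Gamma(TM)$. Then at least one of the following holds: (i) $c=0$; (ii) $(\overline\nabla_{\xi^{\ast}}\theta)(\xi)-(\overline\nabla_{\xi}\theta)(\xi^{\ast})=\eta(\xi)\eta^{\ast}(\xi^{\ast})-\varepsilon$.
   Context: Hermite-like statistical manifold: a semi-Riemannian manifold $(\widetilde M,\widetilde g)$ with two almost complex structures $J,J^{\ast}$ ($J^2=(J^{\ast})^2=-I$) satisfying $\widetilde g(JX,Y)=-\widetilde g(X,J^{\ast}Y)$ for all vector fields $X,Y$, and an affine connection $\widetilde\nabla$ such that $\widetilde\nabla\widetilde g$ is symmetric. The dual connection $\widetilde\nabla^{\ast}$ is defined by $Z\,\widetilde g(X,Y)=\widetilde g(\widetilde\nabla_ZX,Y)+\widetilde g(X,\widetilde\nabla^{\ast}_ZY)$, and $\frac12(\widetilde\nabla+\widetilde\nabla^{\ast})$ is the Levi-Civita connection of $\widetilde g$. It is Kaehler-like if $\widetilde\nabla J=0$ (then also $\widetilde\nabla^{\ast}J^{\ast}=0$). A Kaehler-like statistical manifold has constant holomorphic sectional curvature $c$ ($c$ a constant), and is denoted $\widetilde M(c)$, if the curvature $\widetilde R$ of $\widetilde\nabla$ is $\widetilde R(X,Y)Z=\frac c4\{\widetilde g(Y,Z)X-\widetilde g(X,Z)Y-\widetilde g(Y,JZ)JX+\widetilde g(X,JZ)JY+\widetilde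 g(X,JY)JZ-\widetilde g(JX,Y)JZ\}$. Tangential hypersurface: a non-degenerate hypersurface $(M,g)$, $g$ the induced metric, with unit normal field $N$, such that $JN$ and $J^{\ast}N$ are tangent to $M$. Put $\xi=-JN$, $\xi^{\ast}=-J^{\ast}N$, $\varepsilon=g(\xi,\xi^{\ast})$, $\eta(X)=g(X,\xi)$, $\eta^{\ast}(X)=g(X,\xi^{\ast})$, and define the endomorphism fields $\varphi,\varphi^{\ast}$ of $TM$ by $JX=\varphi X+\varepsilon\eta^{\ast}(X)N$, $J^{\ast}X=\varphi^{\ast}X+\varepsilon\eta(X)N$. Gauss and Weingarten formulas, for $X,Y$ tangent to $M$: $\widetilde\nabla_XY=\nabla_XY+\varepsilon g(A^{\ast}_NX,Y)N$, $\ \widetilde\nabla_XN=-A_NX+\varepsilon\theta(X)N$, $\widetilde\nabla^{\ast}_XY=\nabla^{\ast}_XY+\varepsilon g(A_NX,Y)N$, $\ \widetilde\nabla^{\ast}_XN=-A^{\ast}_NX-\varepsilon\theta(X)N$, where $\nabla,\nabla^{\ast}$ are the induced connections, $A_N,A^{\ast}_N$ the shape operators and $\theta$ a 1-form on $M$. Here $(\nabla_X\varphi)Y=\nabla_X(\varphi Y)-\varphi(\nabla_XY)$ and $(\overline\nabla_X\theta)(Y)=X(\theta(Y))-\theta(\nabla_XY)$. Hopf hypersurface: a tangential hypersurface for which there are smooth functions $\rho,\rho^{\ast}$ with $A_N\xi=\rho\xi$ and $A^{\ast}_N\xi^{\ast}=\rho^{\ast}\xi^{\ast}$.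
   Formalization: When M is a curve (ambient real dimension 2), the formal theorem also assumes ε = 1; for ε = −1 condition (ii) always reads 0 = 2, and the flat plane with metric dx²−dy², J a rotation by π/2, J* = −J, c = 4 and M the x-axis is a counterexample. *)

(* Defs.v *)
From HB Require Import structures.
From mathcomp Require Import all_boot all_order all_algebra.
From mathcomp Require Import all_classical all_reals all_analysis.

Set Implicit Arguments.
Unset Strict Implicit.
Unset Printing Implicit Defensive.

Import Order.TTheory GRing.Theory Num.Theory.
Import numFieldNormedType.Exports.

Local Open Scope classical_set_scope.
Local Open Scope ring_scope.

(* f is C^k on the open set U; 'D_v f is the derivative of f along v. *)
Fixpoint Ck (R : realType) (n k : nat) (U : set 'rV[R]_n) (f : 'rV[R]_n -> R)
    {struct k} : Prop :=
  if k is k'.+1 then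
    (forall x, U x -> differentiable f x) /\ (forall v, Ck k' U ('D_v f))
  else forall x, U x -> {for x, continuous f}.

Definition smooth_on (R : realType) (n : nat) (U : set 'rV[R]_n)
    (f : 'rV[R]_n -> R) : Prop :=
  forall k, Ck k U f.

(* The atlas is indexed by the points of the manifold, which also selects a
   preferred chart [chart p] around each point p. The value of [param p]
   outside of the open set [chart p @` dom p] is irrelevant. *)
Record manifold (R : realType) (n : nat) := Manifold {
  carrier :> topologicalType;
  dom : carrier -> set carrier;
  chart : carrier -> carrier -> 'rV[R]_n;
  param : carrier -> 'rV[R]_n -> carrier;
  manifold_hausdorff : hausdorff_space carrier;
  manifold_second_countable : @second_countable carrier;
  dom_open : forall p, open (dom p);
  mem_dom : forall p, dom p p;
  chart_open : forall p, open (chart p @` dom p);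
  chartK : forall p q, dom p q -> param p (chart p q) = q;
  chart_continuous : forall p q, dom p q -> {for q, continuous (chart p)};
  param_continuous : forall p x, (chart p @` dom p) x ->
    {for x, continuous (param p)};
  transition_smooth : forall p q k,
    smooth_on (chart p @` (dom p `&` dom q))
      (fun x => chart q (param p x) ord0 k) }.

Arguments chart {R n} m p q.
Arguments param {R n} m p x.

(* Functions and fields are total, but only their germs matter: "smooth at p"
   means smooth on some neighbourhood of p. *)
Definition smooth_at (R : realType) (n : nat) (M : manifold R n) (p : M)
    (f : M -> R) : Prop :=
  exists2 U, open_nbhs (chart M p p) U & smooth_on U (f \o param M p).

(* A vector tangent to M at p is represented by its components in the
   preferred chart at p; [dir v f] is the derivative v(f). *)
Definition dir (R : realType) (n : nat) (M : manifold R n) (p : M)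
    (v : 'rV[R]_n) (f : M -> R) : R :=
  'D_v (f \o param M p) (chart M p p).

Definition coord (R : realType) (n : nat) (M : manifold R n) (p : M)
    (k : 'I_n) : M -> R :=
  fun q => chart M p q ord0 k.

Definition smooth_map (R : realType) (m n : nat) (M : manifold R m)
    (N : manifold R n) (i : M -> N) : Prop :=
  continuous i /\
  forall p f, smooth_at (i p) f -> smooth_at p (f \o i).

(* The differential of i at p, as a matrix acting on row vectors. *)
Definition differential (R : realType) (m n : nat) (M : manifold R m)
    (N : manifold R n) (i : M -> N) (p : M) : 'M[R]_(m, n) :=
  \matrix_(j, k) dir p (delta_mx ord0 j) (coord (i p) k \o i).

(* A section s of the pullback of TN by i has s q tangent to N at i q. *)
Definition smooth_along (R : realType) (m n : nat) (M : manifold R m)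
    (N : manifold R n) (i : M -> N) (p : M) (s : M -> 'rV[R]_n) : Prop :=
  forall f : N -> R, smooth_at (i p) f ->
    smooth_at p (fun q => dir (i q) (s q) f).

Definition smooth_vf (R : realType) (n : nat) (M : manifold R n) (p : M)
    (X : M -> 'rV[R]_n) : Prop :=
  smooth_along (@id M) p X.

Definition smooth_fun (R : realType) (n : nat) (M : manifold R n)
    (f : M -> R) : Prop :=
  forall p, smooth_at p f.

(* The components of [X, Y] are [X, Y](x^k) = X(Y(x^k)) - Y(X(x^k)). *)
Definition bracket (R : realType) (n : nat) (M : manifold R n)
    (X Y : M -> 'rV[R]_n) (p : M) : 'rV[R]_n :=
  \row_k (dir p (X p) (fun q => dir q (Y q) (coord p k))
        - dir p (Y p) (fun q => dir q (X q) (coord p k))).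

(* Endomorphism fields act on row vectors from the right: JX is X p *m J p. *)
Definition smooth_endo (R : realType) (n : nat) (M : manifold R n)
    (J : M -> 'M[R]_n) : Prop :=
  forall p X, smooth_vf p X -> smooth_vf p (fun q => X q *m J q).

Definition form (R : realType) (n : nat) (theta : 'cV[R]_n) (v : 'rV[R]_n) : R :=
  (v *m theta) ord0 ord0.

Definition smooth_form (R : realType) (n : nat) (M : manifold R n)
    (theta : M -> 'cV[R]_n) : Prop :=
  forall p X, smooth_vf p X -> smooth_at p (fun q => form (theta q) (X q)).

Definition ip (R : realType) (n : nat) (G : 'M[R]_n) (v w : 'rV[R]_n) : R :=
  (v *m G *m w^T) ord0 ord0.

Definition has_index (R : realType) (n : nat) (G : 'M[R]_n) (nu : nat) : Prop :=
  exists2 P : 'M[R]_n, P \in unitmx &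
    P *m G *m P^T = diag_mx (\row_(i < n) (if (i < nu)%N then -1 else 1)).

Record semi_riemannian (R : realType) (n : nat) (M : manifold R n)
    (g : M -> 'M[R]_n) : Prop := SemiRiemannian {
  metric_sym : forall p, (g p)^T = g p;
  metric_nondegenerate : forall p, g p \in unitmx;
  metric_index : exists2 nu, (nu <= n)%N & forall p, has_index (g p) nu;
  metric_smooth : forall p X Y, smooth_vf p X -> smooth_vf p Y ->
    smooth_at p (fun q => ip (g q) (X q) (Y q)) }.

(* A connection on the pullback of TN by i: [cov p v s] is the derivative of
   the section s in the direction v tangent to M at p. The axioms bear on
   sections defined near p, and they imply that [cov] is local. *)
Record connection_along (R : realType) (m n : nat) (M : manifold R m)
    (N : manifold R n) (i : M -> N) := ConnectionAlong {
  cov :> forall p : M, 'rV[R]_m -> (M -> 'rV[R]_n) -> 'rV[R]_n;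
  cov_linear : forall (p : M) (a : R) u v s, smooth_along i p s ->
    cov p (a *: u + v) s = a *: cov p u s + cov p v s;
  cov_add : forall (p : M) v s t, smooth_along i p s -> smooth_along i p t ->
    cov p v (fun q => s q + t q) = cov p v s + cov p v t;
  cov_leibniz : forall (p : M) v f s, smooth_at p f -> smooth_along i p s ->
    cov p v (fun q => f q *: s q)
      = dir p v f *: s p + f p *: cov p v s;
  cov_smooth : forall (p : M) X s, smooth_vf p X -> smooth_along i p s ->
    smooth_along i p (fun q => cov q (X q) s) }.

Definition connection (R : realType) (n : nat) (M : manifold R n) :=
  connection_along (@id M).

(* D is the (unique) connection induced along i by the connection nabla. *)
Definition is_pullback (R : realType) (m n : nat) (M : manifold R m)
    (N : manifold R n) (i : M -> N) (nabla : connection N)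
    (D : connection_along i) : Prop :=
  forall (p : M) v Z, smooth_vf (i p) Z ->
    D p v (Z \o i) = nabla (i p) (v *m differential i p) Z.

Definition torsion_free (R : realType) (n : nat) (M : manifold R n)
    (nabla : forall p : M, 'rV[R]_n -> (M -> 'rV[R]_n) -> 'rV[R]_n) : Prop :=
  forall p X Y, smooth_vf p X -> smooth_vf p Y ->
    nabla p (X p) Y - nabla p (Y p) X = bracket X Y p.

(* (nabla_v g)(Y, Z) *)
Definition cov_metric (R : realType) (n : nat) (M : manifold R n)
    (nabla : forall p : M, 'rV[R]_n -> (M -> 'rV[R]_n) -> 'rV[R]_n)
    (g : M -> 'M[R]_n) (p : M) (v : 'rV[R]_n) (Y Z : M -> 'rV[R]_n) : R :=
  dir p v (fun q => ip (g q) (Y q) (Z q))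
    - ip (g p) (nabla p v Y) (Z p) - ip (g p) (Y p) (nabla p v Z).

Definition levi_civita (R : realType) (n : nat) (M : manifold R n)
    (g : M -> 'M[R]_n)
    (nabla : forall p : M, 'rV[R]_n -> (M -> 'rV[R]_n) -> 'rV[R]_n) : Prop :=
  torsion_free nabla /\
  forall p v Y Z, smooth_vf p Y -> smooth_vf p Z ->
    cov_metric nabla g p v Y Z = 0.

(* (nabla_v J)Y *)
Definition cov_endo (R : realType) (n : nat) (M : manifold R n)
    (nabla : connection M) (J : M -> 'M[R]_n) (p : M) (v : 'rV[R]_n)
    (Y : M -> 'rV[R]_n) : 'rV[R]_n :=
  nabla p v (fun q => Y q *m J q) - nabla p v Y *m J p.

Definition parallel_endo (R : realType) (n : nat) (M : manifold R n)
    (nabla : connection M) (J : M -> 'M[R]_n) : Prop :=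
  forall (p : M) v Y, smooth_vf p Y -> cov_endo nabla J p v Y = 0.

(* (nabla_v theta)(Y) *)
Definition cov_form (R : realType) (n : nat) (M : manifold R n)
    (nabla : connection M) (theta : M -> 'cV[R]_n) (p : M) (v : 'rV[R]_n)
    (Y : M -> 'rV[R]_n) : R :=
  dir p v (fun q => form (theta q) (Y q)) - form (theta p) (nabla p v Y).

Definition curvature (R : realType) (n : nat) (M : manifold R n)
    (nabla : connection M) (X Y Z : M -> 'rV[R]_n) (p : M) : 'rV[R]_n :=
  nabla p (X p) (fun q => nabla q (Y q) Z)
    - nabla p (Y p) (fun q => nabla q (X q) Z)
    - nabla p (bracket X Y p) Z.

Record hermite_like (R : realType) (n : nat) := HermiteLike {
  space :> manifold R n;
  metric : space -> 'M[R]_n;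
  cpx : space -> 'M[R]_n;
  cpx_dual : space -> 'M[R]_n;
  conn : connection space;
  conn_dual : connection space;
  metric_semi_riemannian : semi_riemannian metric;
  cpx_smooth : smooth_endo cpx;
  cpx_dual_smooth : smooth_endo cpx_dual;
  cpx_square : forall p, cpx p *m cpx p = - 1%:M;
  cpx_dual_square : forall p, cpx_dual p *m cpx_dual p = - 1%:M;
  cpx_adjoint : forall p u v,
    ip (metric p) (u *m cpx p) v = - ip (metric p) u (v *m cpx_dual p);
  cov_metric_sym : forall p X Y Z,
    smooth_vf p X -> smooth_vf p Y -> smooth_vf p Z ->
    cov_metric conn metric p (X p) Y Z = cov_metric conn metric p (Y p) X Z;
  conn_dualE : forall p v X Y, smooth_vf p X -> smooth_vf p Y ->
    dir p v (fun q => ip (metric q) (X q) (Y q))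
      = ip (metric p) (conn p v X) (Y p) + ip (metric p) (X p) (conn_dual p v Y);
  conn_mean_levi_civita :
    levi_civita metric (fun p v Y => 2^-1 *: (conn p v Y + conn_dual p v Y)) }.

Arguments metric {R n} h p.
Arguments cpx {R n} h p.
Arguments cpx_dual {R n} h p.
Arguments conn {R n} h.
Arguments conn_dual {R n} h.

Definition kaehler_like (R : realType) (n : nat) (H : hermite_like R n) : Prop :=
  parallel_endo (conn H) (cpx H).

Definition constant_holomorphic_curvature (R : realType) (n : nat)
    (H : hermite_like R n) (c : R) : Prop :=
  forall (p : H) X Y Z, smooth_vf p X -> smooth_vf p Y -> smooth_vf p Z ->
    let g := ip (metric H p) in
    let J := fun v => v *m cpx H p in
    curvature (conn H) X Y Z p =
      (c / 4) *: (g (Y p) (Z p) *: X p - g (X p) (Z p) *: Y p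
        - g (Y p) (J (Z p)) *: J (X p) + g (X p) (J (Z p)) *: J (Y p)
        + g (X p) (J (Y p)) *: J (Z p) - g (J (X p)) (Y p) *: J (Z p)).

Definition induced_metric (R : realType) (m n : nat) (M : manifold R m)
    (N : manifold R n) (i : M -> N) (g : N -> 'M[R]_n) (p : M) : 'M[R]_m :=
  differential i p *m g (i p) *m (differential i p)^T.

(* A tangential hypersurface (immersed by [emb]), together with the objects
   that its Gauss and Weingarten formulas determine: the induced connections,
   the shape operators and the 1-form theta. [along] and [along_dual] are the
   ambient connections, differentiating ambient fields along M. *)
Record tangential_hypersurface (R : realType) (m : nat)
    (H : hermite_like R m.+1) := TangentialHypersurface {
  hyp :> manifold R m;
  emb : hyp -> H;
  normal : hyp -> 'rV[R]_m.+1;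
  xi : hyp -> 'rV[R]_m;
  xi_dual : hyp -> 'rV[R]_m;
  phi : hyp -> 'M[R]_m;
  phi_dual : hyp -> 'M[R]_m;
  along : connection_along emb;
  along_dual : connection_along emb;
  hconn : connection hyp;
  hconn_dual : connection hyp;
  shape : hyp -> 'M[R]_m;
  shape_dual : hyp -> 'M[R]_m;
  theta : hyp -> 'cV[R]_m;

  hmetric := induced_metric emb (metric H);
  push (p : hyp) (v : 'rV[R]_m) : 'rV[R]_m.+1 := v *m differential emb p;
  eps (p : hyp) : R := ip (hmetric p) (xi p) (xi_dual p);
  eta (p : hyp) (v : 'rV[R]_m) : R := ip (hmetric p) v (xi p);
  eta_dual (p : hyp) (v : 'rV[R]_m) : R := ip (hmetric p) v (xi_dual p);

  emb_smooth : smooth_map emb;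
  emb_immersion : forall p, row_free (differential emb p);
  hmetric_nondegenerate : forall p, hmetric p \in unitmx;

  normal_smooth : forall p, smooth_along emb p normal;
  normal_orthogonal : forall p v,
    ip (metric H (emb p)) (push p v) (normal p) = 0;
  normal_unit :
    (forall p, ip (metric H (emb p)) (normal p) (normal p) = 1) \/
    (forall p, ip (metric H (emb p)) (normal p) (normal p) = -1);

  xi_smooth : forall p, smooth_vf p xi;
  xi_dual_smooth : forall p, smooth_vf p xi_dual;
  phi_smooth : smooth_endo phi;
  phi_dual_smooth : smooth_endo phi_dual;
  xiE : forall p, push p (xi p) = - (normal p *m cpx H (emb p));
  xi_dualE : forall p, push p (xi_dual p) = - (normal p *m cpx_dual H (emb p));
  phiE : forall p v, push p v *m cpx H (emb p)
    = push p (v *m phi p) + (eps p * eta_dual p v) *: normal p;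
  phi_dualE : forall p v, push p v *m cpx_dual H (emb p)
    = push p (v *m phi_dual p) + (eps p * eta p v) *: normal p;

  alongP : is_pullback (conn H) along;
  along_dualP : is_pullback (conn_dual H) along_dual;
  shape_smooth : smooth_endo shape;
  shape_dual_smooth : smooth_endo shape_dual;
  theta_smooth : smooth_form theta;
  gauss : forall p v Y, smooth_vf p Y ->
    along p v (fun q => push q (Y q)) = push p (hconn p v Y)
      + (eps p * ip (hmetric p) (v *m shape_dual p) (Y p)) *: normal p;
  weingarten : forall p v,
    along p v normal = - push p (v *m shape p)
      + (eps p * form (theta p) v) *: normal p;
  gauss_dual : forall p v Y, smooth_vf p Y ->
    along_dual p v (fun q => push q (Y q)) = push p (hconn_dual p v Y)
      + (eps p * ip (hmetric p) (v *m shape p) (Y p)) *: normal p;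
  weingarten_dual : forall p v,
    along_dual p v normal = - push p (v *m shape_dual p)
      - (eps p * form (theta p) v) *: normal p }.

Arguments xi {R m H} t p.
Arguments xi_dual {R m H} t p.
Arguments phi {R m H} t p.
Arguments hconn {R m H} t.
Arguments shape {R m H} t p.
Arguments shape_dual {R m H} t p.
Arguments theta {R m H} t p.
Arguments eps {R m H} t p.
Arguments eta {R m H} t p v.
Arguments eta_dual {R m H} t p v.

Definition hopf (R : realType) (m : nat) (H : hermite_like R m.+1)
    (M : tangential_hypersurface H) : Prop :=
  exists rho rho_dual : M -> R,
    [/\ smooth_fun rho, smooth_fun rho_dual,
        forall p, xi M p *m shape M p = rho p *: xi M p
      & forall p,
          xi_dual M p *m shape_dual M p = rho_dual p *: xi_dual M p].

(* Main.v *)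
(* The structure equations force the plane bundle spanned by N and JN along M to
   be parallel: nabla phi = 0 together with phi xi = 0 makes phi vanish on
   nabla_X xi, so by the Gauss formula for xi = - JN the derivative of
   N = J xi is a combination of N and JN, and so is that of JN as J is
   parallel. Hence R(X, Y)N is such a combination. Comparing with the formula
   for the curvature of constant holomorphic sectional curvature c <> 0, applied
   to Z = N, and multiplying by J, one finds that eta(Y)X - eta(X)Y is a multiple
   of xi for all tangent X, Y. As eta(xi^* ) <> 0, xi and xi^* span the tangent
   space of M, whose dimension m is odd because J acts on a space of dimension
   m + 1; so m = 1. For curves the left side of (ii) vanishes by alternation and
   the right side is eps^2 - eps = 0.

   The curvature along M is computed with coordinate fields of M and the
   coordinate frame of the ambient space, which needs the symmetry of second
   derivatives and the invariance of smoothness under changes of charts. *)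
From HB Require Import structures.
Require Import Defs.
From mathcomp Require Import all_boot all_order all_algebra.
From mathcomp Require Import all_classical all_reals all_analysis.
From mathcomp Require Import ring.

Set Implicit Arguments.
Unset Strict Implicit.
Unset Printing Implicit Defensive.

Import Order.TTheory GRing.Theory Num.Theory.
Import numFieldNormedType.Exports.
Local Open Scope classical_set_scope.
Local Open Scope ring_scope.

(* MathComp also defines [coord] (in vector) and [form] (in sesquilinear). *)
Local Notation coord := Defs.coord.
Local Notation form := Defs.form.

(** * Functions of class C^k and symmetry of second derivatives *)

(** The first-order expansion of [f] at [x] only involves values near [x], so it is also one for
    [g]; by uniqueness the differentials agree. *)
Lemma near_differentiable (K : numFieldType) (V W : normedModType K)
    (f g : V -> W) (x : V) :
  (\forall y \near x, f y = g y) -> differentiable f x -> differentiable g x.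
Proof.
move=> fg df.
have H : g \o shift x = cst (g x) + 'd f x +o_ 0 id.
  apply/eqaddoP => e e0; have /eqaddoP/(_ e e0) := diff_locally df.
  rewrite -(nbhs_singleton fg) near_simpl => H.
  have fg0 : \forall h \near (0 : V), f (h + x) = g (h + x).
    move: fg; rewrite (near_shift 0 x) /=.
    by apply: filterS => h; rewrite /= subr0.
  near=> h.
  have <- : (f \o shift x - (cst (f x) + 'd f x)) h
     = (g \o shift x - (cst (f x) + 'd f x)) h.
    rewrite /GRing.opp/GRing.add/=; congr (_ + _).
    by near: h.
  by near: h.
have e : 'd g x = 'd f x :> (_ -> _) by apply: diff_unique => //; exact: diff_continuous.
by apply/diff_locallyP; rewrite e; split=> //; exact: diff_continuous.
Unshelve. all: by end_near. Qed.

Section Ck_theory.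
Variables (R : realType) (n : nat).
Implicit Types (U V : set 'rV[R]_n) (f g : 'rV[R]_n -> R) (x u v : 'rV[R]_n).

Lemma open_near (T : topologicalType) (U : set T) (x : T) (P : T -> Prop) :
  open U -> U x -> (forall y, U y -> P y) -> \forall y \near x, P y.
Proof.
move=> oU Ux UP; apply: (@filterS _ _ _ U P) => //.
exact: open_nbhs_nbhs.
Qed.

Lemma Ck_eq k U f g : open U -> (forall x, U x -> f x = g x) ->
  Ck k U f -> Ck k U g.
Proof.
move=> oU; elim: k f g => [|k IH] f g fg /=.
  move=> cf x Ux; change (g @ nbhs x --> g x); rewrite -fg//.
  have fgx : {near nbhs x, f =1 g} by apply: open_near oU Ux _ => y /fg.
  exact: (cvg_trans (near_eq_cvg fgx) (cf x Ux)).
case=> df Df; split=> [x Ux|v].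
  apply: near_differentiable (df x Ux).
  by apply: open_near oU Ux _ => y /fg.
apply: IH (Df v) => x Ux; apply: near_eq_derive.
by apply: open_near oU Ux _ => y /fg.
Qed.

Lemma Ck_sub k U V f : V `<=` U -> Ck k U f -> Ck k V f.
Proof.
move=> VU; elim: k f => [|k IH] f /=; first by move=> cf x /VU /cf.
by case=> df Df; split=> [x /VU /df|v]; last exact: IH.
Qed.

Lemma CkW k U f : Ck k.+1 U f -> Ck k U f.
Proof.
elim: k f => [|k IH] f; first by case=> df _ x /df/differentiable_continuous.
by case=> df Df; split=> // v; apply: IH.
Qed.

Lemma Ck_cst k U (a : R) : Ck k U (fun=> a).
Proof.
elim: k a => [|k IH] a /=; first by move=> x _; exact: cst_continuous.
split=> [x _|v]; first exact: differentiable_cst.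
rewrite (_ : 'D_v _ = fun=> 0) //; apply/funext => x; exact: derive_cst.
Qed.

Lemma CkD k U f g : open U -> Ck k U f -> Ck k U g ->
  Ck k U (fun x => f x + g x).
Proof.
move=> oU; elim: k f g => [|k IH] f g /=.
  by move=> cf cg x Ux; exact: (@continuousD _ _ _ f g x (cf x Ux) (cg x Ux)).
move=> [df Df] [dg Dg]; split=> [x Ux|v].
  by apply: differentiableD; [exact: df|exact: dg].
apply: Ck_eq (IH _ _ (Df v) (Dg v)) => // x Ux.
by rewrite (@deriveD _ _ _ f g)//; apply: diff_derivable; [apply: df|apply: dg].
Qed.

Lemma CkM k U f g : open U -> Ck k U f -> Ck k U g ->
  Ck k U (fun x => f x * g x).
Proof.
move=> oU; elim: k f g => [|k IH] f g.
  by move=> cf cg x Ux; exact: (@continuousM _ _ f g x (cf x Ux) (cg x Ux)).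
move=> cf cg; have [df Df] := cf; have [dg Dg] := cg; split=> [x Ux|v].
  by apply: differentiableM; [exact: df|exact: dg].
apply: Ck_eq (CkD oU (IH _ _ (CkW cf) (Dg v)) (IH _ _ (CkW cg) (Df v))) => // x Ux.
by rewrite (@deriveM _ _ f g)//; apply: diff_derivable; [apply: df|apply: dg].
Qed.

Lemma Ck_sum k U (I : Type) (r : seq I) (F : I -> 'rV[R]_n -> R) : open U ->
  (forall i, Ck k U (F i)) -> Ck k U (fun x => \sum_(i <- r) F i x).
Proof.
move=> oU cF; elim: r => [|i r IH].
  by apply: Ck_eq (Ck_cst k U 0) => // x _; rewrite big_nil.
by apply: Ck_eq (CkD oU (cF i) IH) => // x _; rewrite big_cons.
Qed.

Lemma derive_row_coord (i : 'I_n) x v :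
  'D_v (fun y : 'rV[R]_n => y ord0 i : R) x = v ord0 i.
Proof.
rewrite deriveE; last exact: differentiable_coord.
have lin : linear (fun y : 'rV[R]_n => y ord0 i : R).
  by move=> a u w; rewrite !mxE.
pose l := GRing.isLinear.Build _ _ _ _ _ lin.
pose L : {linear 'rV[R]_n -> R} := HB.pack (fun y : 'rV[R]_n => y ord0 i : R) l.
by rewrite (@diff_lin _ _ _ L)//; apply: coord_continuous.
Qed.

Lemma Ck_coord k U (i : 'I_n) : Ck k U (fun x => x ord0 i).
Proof.
case: k => [|k]; first by move=> x _; apply: coord_continuous.
split=> [x _|v]; first exact: differentiable_coord.
by rewrite (_ : 'D_v _ = fun=> v ord0 i);
  [exact: Ck_cst|apply/funext => x; exact: derive_row_coord].
Qed.

Lemma derive_linear f x (a : R) u v : differentiable f x ->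
  'D_(a *: u + v) f x = a * 'D_u f x + 'D_v f x.
Proof. by move=> df; rewrite !deriveE// linearP. Qed.

Lemma derive_basis f x v : differentiable f x ->
  'D_v f x = \sum_i v ord0 i * 'D_(delta_mx ord0 i) f x.
Proof.
move=> df; rewrite [in LHS](row_sum_delta v) deriveE// linear_sum/=.
by apply: eq_bigr => i _; rewrite linearZ/= deriveE.
Qed.

Lemma is_derive_line f x u (s : R) : differentiable f (x + s *: u) ->
  is_derive s 1 (fun t : R => f (x + t *: u)) ('D_u f (x + s *: u)).
Proof.
move=> df; have dl : is_diff s (fun t : R => x + t *: u) ( *:%R^~ u).
  by apply: is_diff_eq; rewrite add0r.
have dg : differentiable (fun t : R => f (x + t *: u)) s.
  by apply: (@differentiable_comp _ _ _ _ (fun t : R => x + t *: u) f).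
apply: DeriveDef; first exact/derivable1_diffP.
rewrite deriveE// (@diff_comp _ _ _ _ (fun t : R => x + t *: u) f)//=.
by rewrite diff_val scale1r deriveE.
Qed.

(** The mean value theorem is applied twice: along [u] to the difference of [f] between two opposite
    sides of the parallelogram, then along [v] to the derivative ['D_u f]. The set [W] stands for
    any set that contains the parallelogram. *)
Lemma second_difference f u v x (t : R) (W : set 'rV[R]_n) : 0 < t ->
  (forall s s' : R, 0 <= s <= t -> 0 <= s' <= t -> W (x + s *: u + s' *: v)) ->
  (forall y, W y -> differentiable f y) ->
  (forall y, W y -> differentiable ('D_u f) y) ->
  exists2 z, W z & f (x + t *: u + t *: v) - f (x + t *: u)
     - f (x + t *: v) + f x = 'D_v ('D_u f) z * t ^+ 2.
Proof.
move=> t0 Wz df dDf.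
pose F (s : R) := f (x + s *: u + t *: v) - f (x + s *: u).
pose dF (s : R) := 'D_u f (x + s *: u + t *: v) - 'D_u f (x + s *: u).
have tt : 0 <= t <= t by apply/andP; split=> //; exact: ltW.
have t00 : (0 : R) <= 0 <= t by apply/andP; split=> //; exact: ltW.
have W0 (s : R) : 0 <= s <= t -> W (x + s *: u).
  by move=> /Wz/(_ t00); rewrite scale0r addr0.
have dFP (s : R) : 0 <= s <= t -> is_derive s 1 F (dF s).
  move=> st; apply: is_deriveB.
    have := @is_derive_line f (x + t *: v) u s.
    by rewrite addrAC => /(_ (df _ (Wz _ _ st tt))); under eq_fun do rewrite addrAC.
  exact: is_derive_line (df _ (W0 _ st)).
have [s |c|c] := @MVT R F dF 0 t t0.
- by rewrite in_itv/= => /andP[s0 s1]; apply: dFP; rewrite !ltW.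
- apply: derivable_within_continuous => s; rewrite in_itv/= => st.
  by have [] := dFP s st.
rewrite in_itv/= subr0 => /andP[c0 ct] E.
have cc : 0 <= c <= t by rewrite !ltW.
have dG (s : R) : 0 <= s <= t ->
   is_derive s 1 (fun s : R => 'D_u f (x + c *: u + s *: v))
     ('D_v ('D_u f) (x + c *: u + s *: v)).
  by move=> st; apply: is_derive_line; apply: dDf; exact: Wz.
have [s |d|d] := @MVT R (fun s => 'D_u f (x + c *: u + s *: v))
  (fun s => 'D_v ('D_u f) (x + c *: u + s *: v)) 0 t t0.
- by rewrite in_itv/= => /andP[s0 s1]; apply: dG; rewrite !ltW.
- apply: derivable_within_continuous => s; rewrite in_itv/= => st.
  by have [] := dG s st.
rewrite in_itv/= subr0 scale0r addr0 => /andP[d0 dt] E2.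
exists (x + c *: u + d *: v); first by apply: Wz => //; rewrite !ltW.
move: E; rewrite /F scale0r addr0 /dF E2 => E.
by rewrite expr2 mulrA -E; ring.
Qed.

(** The second difference of [f] is symmetric in [u] and [v], so on every small parallelogram the
    two mixed derivatives share a value, taken at possibly different points. Continuity at [x] then
    bounds their difference there by any [e > 0]. *)
Lemma derive_sym U f u v x : open U -> U x -> Ck 2 U f ->
  'D_u ('D_v f) x = 'D_v ('D_u f) x.
Proof.
move=> oU Ux [df Df].
apply/eqP; rewrite -subr_eq0 -normr_le0; apply/ler_addgt0Pr => e e0; rewrite add0r.
have e20 : 0 < e / 2 by rewrite divr_gt0.
have c1 : {for x, continuous ('D_u ('D_v f))} by apply: (Df v).2.
have c2 : {for x, continuous ('D_v ('D_u f))} by apply: (Df u).2.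
have /cvgrPdist_lt/(_ _ e20) n1 := c1.
have /cvgrPdist_lt/(_ _ e20) n2 := c2.
have n3 : \forall y \near x, U y by exact: open_near oU Ux _.
have [r /= r0 rW] : exists2 r : R, 0 < r & ball x r `<=`
    [set y | U y /\ `|'D_u ('D_v f) x - 'D_u ('D_v f) y| < e / 2
               /\ `|'D_v ('D_u f) x - 'D_v ('D_u f) y| < e / 2].
  apply/nbhs_ballP; exact: filterI n3 (filterI n1 n2).
(* This side length keeps the parallelogram on [t *: u] and [t *: v] inside the ball of radius [r];
   the summand 1 keeps the denominator positive when [u = v = 0]. *)
pose t := r / 2 / (1 + `|u| + `|v|).
have k0 : 0 < 1 + `|u| + `|v| by rewrite -addrA ltr_pwDl// addr_ge0.
have t0 : 0 < t by rewrite !divr_gt0.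
have Wst (s s' : R) : 0 <= s <= t -> 0 <= s' <= t -> ball x r (x + s *: u + s' *: v).
  move=> /andP[s0 st] /andP[s0' st'].
  rewrite -ball_normE /ball_/= -addrA opprD addNKr normrN.
  rewrite (le_lt_trans (ler_normD _ _))// !normrZ !ger0_norm//.
  rewrite (@le_lt_trans _ _ (t * (`|u| + `|v|)))//.
    by rewrite mulrDr lerD// ler_wpM2r.
  rewrite (@le_lt_trans _ _ (r / 2))//; last by rewrite ltr_pdivrMr// ltr_pMr// ltr1n.
  rewrite /t -mulrA ger_pMr ?divr_gt0// mulrC ler_pdivrMr// mul1r.
  by rewrite -addrA lerDr.
have [z Wz Ez] := @second_difference f u v x t (ball x r) t0 Wst
  (fun y h => df y (rW y h).1) (fun y h => (Df u).1 y (rW y h).1).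
have Wst' (s s' : R) : 0 <= s <= t -> 0 <= s' <= t -> ball x r (x + s *: v + s' *: u).
  by move=> h h'; rewrite addrAC; exact: Wst.
have [w Ww Ew] := @second_difference f v u x t (ball x r) t0 Wst'
  (fun y h => df y (rW y h).1) (fun y h => (Df v).1 y (rW y h).1).
have E : 'D_v ('D_u f) z = 'D_u ('D_v f) w.
  apply: (@mulIf _ (t ^+ 2)); first by rewrite expf_neq0// gt_eqF.
  apply: etrans (esym Ez) (etrans _ Ew).
  rewrite [x + t *: v + _]addrAC; congr (_ + _); exact: addrAC.
have [_ [w1 _]] := rW _ Ww; have [_ [_ z2]] := rW _ Wz.
apply: le_trans (ler_distD ('D_u ('D_v f) w) _ _) _; rewrite (splitr e).
apply: lerD; apply: ltW; first exact: w1.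
rewrite -E distrC; exact: z2.
Qed.

End Ck_theory.

(** * Chain rule and composition of C^k maps *)

Section composition.
Variables (R : realType) (m n : nat).
Implicit Types (h : 'rV[R]_m -> 'rV[R]_n) (f : 'rV[R]_n -> R).

Lemma differentiable_row h x :
  (forall k, differentiable (fun y => h y ord0 k : R) x) -> differentiable h x.
Proof.
move=> dh.
have -> : h = \sum_(k < n) (fun y => h y ord0 k *: delta_mx ord0 k).
  apply/funext => y; rewrite fct_sumE; exact: row_sum_delta.
by apply: differentiable_sum => k; exact: differentiableZl.
Qed.

Lemma derive_comp h f x v :
  (forall k, differentiable (fun y => h y ord0 k : R) x) ->
  differentiable f (h x) ->
  'D_v (f \o h) x
    = \sum_k 'D_v (fun y => h y ord0 k) x * 'D_(delta_mx ord0 k) f (h x).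
Proof.
move=> dh df; have dhx := differentiable_row dh.
rewrite deriveE; last exact: differentiable_comp.
rewrite diff_comp//= -deriveE// derive_basis//; apply: eq_bigr => k _.
congr (_ * _); rewrite -deriveE// derive_mx ?mxE//.
exact: diff_derivable.
Qed.

Lemma row_continuous h x :
  (forall k, {for x, continuous (fun y => h y ord0 k : R)}) ->
  {for x, continuous h}.
Proof.
move=> ch A [P nP PA].
have H : \forall y \near x, forall i j, P i j (h y i j).
  have H j : \forall y \near x, P ord0 j (h y ord0 j) by exact: ch (nP ord0 j).
  by apply: filterS (filter_forall _ H) => y Py i j; rewrite (ord1 i).
by apply: (@filterS _ _ _ _ _ _ H) => y Py; exact: PA.
Qed.

(** By the chain rule a derivative of [f \o h] is a sum of products of derivatives of [h] with
    partial derivatives of [f] composed with [h], to which the induction hypothesis applies. *)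
Lemma Ck_comp k (U : set 'rV[R]_m) (V : set 'rV[R]_n) h f :
  open U -> (forall x, U x -> V (h x)) ->
  (forall i, Ck k U (fun x => h x ord0 i)) -> Ck k V f -> Ck k U (f \o h).
Proof.
move=> oU UV; elim: k f => [|k IH] f ch cf.
  move=> x Ux; apply: continuous_comp; last by apply: cf; exact: UV.
  by apply: row_continuous => i; exact: ch.
have dh x : U x -> forall i, differentiable (fun y => h y ord0 i : R) x.
  by move=> Ux i; apply: (ch i).1.
split=> [x Ux|v].
  apply: differentiable_comp; first by apply: differentiable_row; exact: dh.
  by apply: cf.1; exact: UV.
apply: (@Ck_eq _ _ _ _ (fun x => \sum_i 'D_v (fun y => h y ord0 i) x
    * ('D_(delta_mx ord0 i) f \o h) x)) => //.
  move=> x Ux; rewrite derive_comp//; first exact: dh.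
  by apply: cf.1; exact: UV.
apply: Ck_sum => // i; apply: CkM => //; first exact: (ch i).2.
by apply: IH (cf.2 _) => j; apply: CkW.
Qed.

End composition.

(** * Germs of smooth functions on R^n *)

Section smooth_near.
Variables (R : realType) (n : nat).
Implicit Types (F G : 'rV[R]_n -> R) (x v : 'rV[R]_n).

(** Read in the preferred chart at [p], this is [smooth_at p] by conversion; leaving the point free
    allows smoothness to be tested in other charts. *)
Definition smooth_near x F : Prop :=
  exists2 U, open_nbhs x U & smooth_on U F.

Lemma smooth_near_near x F : smooth_near x F -> \forall y \near x, smooth_near y F.
Proof.
by case=> U [oU Ux] sF; apply: (open_near oU Ux) => y Uy; exists U.
Qed.

Lemma smooth_near_eq x F G : (\forall y \near x, F y = G y) ->
  smooth_near x F -> smooth_near x G.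
Proof.
move=> FG [U [oU Ux] sF].
exists (U `&` (fun y => F y = G y)^°).
  by split; [apply: openI => //; exact: open_interior|split].
move=> k; apply: (@Ck_eq _ _ _ _ F).
- by apply: openI => //; exact: open_interior.
- by move=> y [_ /interior_subset].
- by apply: Ck_sub (sF k) => y [].
Qed.

Lemma smooth_near_cst x (a : R) : smooth_near x (fun=> a).
Proof. by exists setT; [split; [exact: openT|]|move=> k; exact: Ck_cst]. Qed.

Lemma smooth_near_coord x (i : 'I_n) : smooth_near x (fun y => y ord0 i).
Proof. by exists setT; [split; [exact: openT|]|move=> k; exact: Ck_coord]. Qed.

Lemma smooth_nearD x F G : smooth_near x F -> smooth_near x G ->
  smooth_near x (fun y => F y + G y).
Proof.
move=> [U [oU Ux] sF] [V [oV Vx] sG]; have oUV := openI oU oV.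
by exists (U `&` V) => // k; apply: CkD => //;
  [apply: Ck_sub (sF k) => y []|apply: Ck_sub (sG k) => y []].
Qed.

Lemma smooth_nearM x F G : smooth_near x F -> smooth_near x G ->
  smooth_near x (fun y => F y * G y).
Proof.
move=> [U [oU Ux] sF] [V [oV Vx] sG]; have oUV := openI oU oV.
by exists (U `&` V) => // k; apply: CkM => //;
  [apply: Ck_sub (sF k) => y []|apply: Ck_sub (sG k) => y []].
Qed.

Lemma smooth_near_derive x F v : smooth_near x F -> smooth_near x ('D_v F).
Proof. by case=> U Ux sF; exists U => // k; exact: (sF k.+1).2. Qed.

Lemma smooth_near_differentiable x F : smooth_near x F -> differentiable F x.
Proof. by case=> U [oU Ux] sF; exact: (sF 1).1. Qed.

Lemma smooth_near_derive_sym x F u v : smooth_near x F ->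
  'D_u ('D_v F) x = 'D_v ('D_u F) x.
Proof. by case=> U [oU Ux] sF; exact: (@derive_sym _ _ U). Qed.

End smooth_near.

Lemma smooth_near_comp (R : realType) (m n : nat) (h : 'rV[R]_m -> 'rV[R]_n)
    (F : 'rV[R]_n -> R) (x : 'rV[R]_m) :
  (forall i, smooth_near x (fun y => h y ord0 i)) -> smooth_near (h x) F ->
  smooth_near x (F \o h).
Proof.
move=> sh [V [oV Vhx] sF].
pose S y := forall i, smooth_near y (fun y => h y ord0 i).
have nx : nbhs x S^°.
  apply: nbhs_interior; exact: filter_forall (fun i => smooth_near_near (sh i)).
have ch : {for x, continuous h}.
  apply: differentiable_continuous; apply: differentiable_row => k.
  exact: smooth_near_differentiable.
have nV : nbhs x (h @^-1` V)^° by apply: nbhs_interior; apply: ch; exact: open_nbhs_nbhs.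
pose W := S^° `&` (h @^-1` V)^°.
have oW : open W by apply: openI; exact: open_interior.
exists W; first by split=> //; split; exact: nbhs_singleton.
move=> k; apply: (@Ck_comp _ _ _ k W V) => // [y [_ /interior_subset]//|i].
(* Generalized to any function that is smooth near each point of [W], a class stable under
   derivatives. *)
elim: k (fun y => h y ord0 i) (fun y (Wy : W y) => interior_subset Wy.1 i) => [|k IH] G sG /=.
  by move=> y /sG/smooth_near_differentiable/differentiable_continuous.
split=> [y /sG/smooth_near_differentiable//|v].
by apply: IH => y /sG/smooth_near_derive.
Qed.

(** * Coordinate fields on a manifold *)

Section charts.
Variables (R : realType) (n : nat) (M : manifold R n).
Implicit Types (p q y : M) (f g : M -> R) (u v w : 'rV[R]_n) (k : 'I_n).

Lemma dom_near p q : dom p q -> \forall y \near q, dom p y.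
Proof. by move=> pq; apply: open_near pq _ => //; exact: dom_open. Qed.

Lemma chart_dom p q : dom p q -> (chart M p @` dom p) (chart M p q).
Proof. by exists q. Qed.

Lemma param_near p q : dom p q -> \forall x \near chart M p q,
  dom p (param M p x) /\ chart M p (param M p x) = x.
Proof.
move=> pq; apply: (@open_near _ (chart M p @` dom p)).
- exact: chart_open.
- exact: chart_dom.
- by move=> _ [y py <-]; rewrite chartK.
Qed.

Lemma near_param p q (P : M -> Prop) : dom p q ->
  (\forall y \near q, P y) -> \forall x \near chart M p q, P (param M p x).
Proof.
move=> pq Pq; have := param_continuous (chart_dom pq).
by rewrite /prop_for /continuous_at chartK//; apply.
Qed.

Lemma near_chart p q (P : 'rV[R]_n -> Prop) : dom p q ->
  (\forall x \near chart M p q, P x) -> \forall y \near q, P (chart M p y).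
Proof. by move=> pq Pq; have := chart_continuous pq; apply. Qed.

(** The transition map is smooth on the image of the overlap. That this image is open follows from
    the openness of chart images and domains and from the continuity of [param]. *)
Lemma smooth_near_transition p q y k : dom p y -> dom q y ->
  smooth_near (chart M p y) (coord q k \o param M p).
Proof.
move=> py qy; exists (chart M p @` (dom p `&` dom q)); last exact: transition_smooth.
split; last by exists y.
rewrite openE => _ [z [pz qz] <-].
have n1 := param_near pz; have n2 := near_param pz (dom_near qz).
rewrite /interior; near=> x.
have [px xE] : dom p (param M p x) /\ chart M p (param M p x) = x by near: x.
by exists (param M p x) => //; split=> //; near: x.
Unshelve. all: by end_near. Qed.

Lemma comp_param_near p q y f : dom p y -> dom q y ->
  \forall x \near chart M p y,
    ((f \o param M q) \o (chart M q \o param M p)) x = (f \o param M p) x.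
Proof.
move=> py qy; apply: filterS (near_param py (dom_near qy)) => x /= qx.
by rewrite chartK.
Qed.

Lemma smooth_chart_change p q y f : dom p y -> dom q y ->
  smooth_near (chart M q y) (f \o param M q) ->
  smooth_near (chart M p y) (f \o param M p).
Proof.
move=> py qy sf; apply: smooth_near_eq (comp_param_near f py qy) _.
apply: smooth_near_comp; last by rewrite /= chartK.
by move=> i; exact: smooth_near_transition.
Qed.

(** Smoothness at [q] is defined in the preferred chart at [q]; here it may be tested in the fixed
    chart at [p], which is what statements about all [q] near [p] require. *)
Lemma smooth_atP p q f : dom p q ->
  smooth_at q f <-> smooth_near (chart M p q) (f \o param M p).
Proof.
move=> pq; split; [exact: smooth_chart_change (mem_dom _)|].
exact: (smooth_chart_change (mem_dom q)).
Qed.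

Lemma derive_chart_change p q y f v : dom p y -> dom q y -> smooth_at y f ->
  'D_v (f \o param M p) (chart M p y)
   = \sum_k 'D_v (coord q k \o param M p) (chart M p y)
       * 'D_(delta_mx ord0 k) (f \o param M q) (chart M q y).
Proof.
move=> py qy sf; rewrite -(near_eq_derive _ (comp_param_near f py qy)).
rewrite derive_comp /= ?chartK//.
  by move=> k; apply: smooth_near_differentiable; exact: smooth_near_transition.
by apply: smooth_near_differentiable; apply/smooth_atP.
Qed.

Lemma smooth_at_near p f : smooth_at p f -> \forall q \near p, smooth_at q f.
Proof.
move=> /smooth_near_near/(near_chart (mem_dom p)).
apply: filterS2 (dom_near (mem_dom p)) => q pq sf.
exact/(smooth_atP _ pq).
Qed.

Lemma smooth_at_eq p f g : (\forall q \near p, f q = g q) ->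
  smooth_at p f -> smooth_at p g.
Proof.
move=> fg; apply: smooth_near_eq; exact: near_param (mem_dom p) fg.
Qed.

Lemma smooth_at_cst p (a : R) : smooth_at p (fun=> a).
Proof. exact: smooth_near_cst. Qed.

Lemma smooth_atD p f g : smooth_at p f -> smooth_at p g ->
  smooth_at p (fun q => f q + g q).
Proof. exact: smooth_nearD. Qed.

Lemma smooth_atM p f g : smooth_at p f -> smooth_at p g ->
  smooth_at p (fun q => f q * g q).
Proof. exact: smooth_nearM. Qed.

Lemma smooth_at_sum p (I : Type) (r : seq I) (F : I -> M -> R) :
  (forall i, smooth_at p (F i)) -> smooth_at p (fun q => \sum_(i <- r) F i q).
Proof.
move=> sF; elim: r => [|i r IH].
  by under eq_fun do rewrite big_nil; exact: smooth_at_cst.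
by under eq_fun do rewrite big_cons; exact: smooth_atD.
Qed.

Lemma coord_param_near p q k : dom p q ->
  \forall x \near chart M p q, (fun y : 'rV[R]_n => y ord0 k) x = (coord p k \o param M p) x.
Proof. by move=> /param_near; apply: filterS => x [_ /= E]; rewrite /coord E. Qed.

Lemma smooth_at_coord p q k : dom p q -> smooth_at q (coord p k).
Proof.
move=> pq; apply/(smooth_atP _ pq).
exact: smooth_near_eq (coord_param_near k pq) (smooth_near_coord _ _).
Qed.

Lemma dir_eq p v f g : (\forall q \near p, f q = g q) -> dir p v f = dir p v g.
Proof. by move=> fg; apply: near_eq_derive; exact: near_param (mem_dom p) fg. Qed.

Lemma smooth_at_derivable p v f : smooth_at p f ->
  derivable (f \o param M p) (chart M p p) v.
Proof. by move=> sf; apply/diff_derivable/smooth_near_differentiable. Qed.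

Lemma dir_linear p (a : R) u v f : smooth_at p f ->
  dir p (a *: u + v) f = a * dir p u f + dir p v f.
Proof. by move=> sf; apply/derive_linear/smooth_near_differentiable. Qed.

Lemma dir_cst p v (a : R) : dir p v (fun=> a) = 0.
Proof. exact: derive_cst. Qed.

Lemma dirM p v f g : smooth_at p f -> smooth_at p g ->
  dir p v (fun q => f q * g q) = f p * dir p v g + g p * dir p v f.
Proof.
move=> sf sg; rewrite /dir (@deriveM _ _ (f \o param M p) (g \o param M p));
  [|exact: smooth_at_derivable|exact: smooth_at_derivable].
by rewrite /= chartK//; exact: mem_dom.
Qed.

Lemma derive_coord_param p q k v : dom p q ->
  'D_v (coord p k \o param M p) (chart M p q) = v ord0 k.
Proof.
move=> pq; rewrite -(near_eq_derive _ (coord_param_near k pq)).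
exact: derive_row_coord.
Qed.

Lemma dir_coord p k v : dir p v (coord p k) = v ord0 k.
Proof. by apply: derive_coord_param; exact: mem_dom. Qed.

(** The coordinate field with constant components [v] in the chart at [p]. Vectors at [q] are
    written in the preferred chart at [q], so the differential of the transition map appears. *)
Definition cfield p v q : 'rV[R]_n :=
  \row_k 'D_v (coord q k \o param M p) (chart M p q).

Lemma dir_cfield p q v f : dom p q -> smooth_at q f ->
  dir q (cfield p v q) f = 'D_v (f \o param M p) (chart M p q).
Proof.
move=> pq sf; rewrite (@derive_chart_change p q q)//; last exact: mem_dom.
rewrite /dir derive_basis; last exact: smooth_near_differentiable.
by apply: eq_bigr => k _; rewrite mxE.
Qed.

Lemma cfield_id p v : cfield p v p = v.
Proof. by apply/rowP => k; rewrite mxE; exact: dir_coord. Qed.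

Lemma smooth_at_derive_param p q v f : dom p q -> smooth_at q f ->
  smooth_at q (fun y => 'D_v (f \o param M p) (chart M p y)).
Proof.
move=> pq /(smooth_atP _ pq)/(smooth_near_derive v) sf.
apply/(smooth_atP _ pq); apply: smooth_near_eq sf.
by apply: filterS (param_near pq) => x [_ /= ->].
Qed.

Lemma smooth_cfield p q v : dom p q -> smooth_vf q (cfield p v).
Proof.
move=> pq f sf; apply: smooth_at_eq (smooth_at_derive_param v pq sf).
apply: filterS2 (dom_near pq) (smooth_at_near sf) => y py sfy.
by rewrite dir_cfield.
Qed.

Lemma cfield_frame p q w : dom p q ->
  w = \sum_k dir q w (coord p k) *: cfield p (delta_mx ord0 k) q.
Proof.
move=> pq; apply/rowP => j; rewrite -(dir_coord q j w).
rewrite /dir (@derive_chart_change q p q)//; [|exact: mem_dom|]; last first.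
  by apply: smooth_at_coord; exact: mem_dom.
by rewrite summxE; apply: eq_bigr => k _; rewrite !mxE.
Qed.

(** Both sides are iterated derivatives in the single chart at [p], where second derivatives
    commute. *)
Lemma dir_cfield_sym p u v f : smooth_at p f ->
  dir p u (fun q => dir q (cfield p v q) f)
    = dir p v (fun q => dir q (cfield p u q) f).
Proof.
move=> sf; have H w z : dir p w (fun q => dir q (cfield p z q) f)
    = 'D_w ('D_z (f \o param M p)) (chart M p p).
  rewrite (@dir_eq p w _ (fun q => 'D_z (f \o param M p) (chart M p q))).
    apply: near_eq_derive; apply: filterS (param_near (mem_dom p)) => x [_].
    by move=> /= ->.
  apply: filterS2 (dom_near (mem_dom p)) (smooth_at_near sf) => y py sfy.
  by rewrite dir_cfield.
by rewrite !H; exact: smooth_near_derive_sym.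
Qed.

Lemma bracket_cfield p u v : bracket (cfield p u) (cfield p v) p = 0.
Proof.
have H w z k : dir p w (fun q => dir q (cfield p z q) (coord p k)) = 0.
  rewrite -(dir_cst p w (z ord0 k)); apply: dir_eq.
  apply: filterS (dom_near (mem_dom p)) => q pq.
  by rewrite dir_cfield ?derive_coord_param//; exact: smooth_at_coord.
by apply/rowP => k; rewrite !mxE !H subrr.
Qed.

End charts.

(** * Sections and connections along a map *)

Lemma near_near (T : topologicalType) (x : T) (P : T -> Prop) :
  (\forall y \near x, P y) -> \forall y \near x, \forall z \near y, P z.
Proof. exact: nbhs_interior. Qed.

Lemma linear_lincomb (R : pzRingType) (U V : lmodType R) (f : U -> V)
    (I : finType) (c : I -> R) (e : I -> U) :
  (forall (a : R) u v, f (a *: u + v) = a *: f u + f v) ->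
  f (\sum_k c k *: e k) = \sum_k c k *: f (e k).
Proof.
move=> fL; have f0 : f 0 = 0.
  by have := fL (-1) 0 0; rewrite scaler0 addr0 scaleN1r addNr.
by elim/big_rec2: _ => // k x y _ <-; exact: fL.
Qed.

Section sections_along.
Unset Implicit Arguments.
Context {R : realType} {m n : nat} {M : manifold R m} {N : manifold R n}.
Context {i : M -> N} (smooth_i : smooth_map i).
Implicit Types (p q : M) (s t : M -> 'rV[R]_n) (f : M -> R).
Implicit Types (u v w : 'rV[R]_m).

Lemma near_comp {p} {P : N -> Prop} : (\forall y \near i p, P y) ->
  \forall q \near p, P (i q).
Proof. by move=> nP; apply: smooth_i.1. Qed.

(** The chain rule for the expression of [i] in the preferred charts at [q] and [i q]. *)
Lemma dir_differential {q} v {f : N -> R} : smooth_at (i q) f ->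
  dir (i q) (v *m differential i q) f = dir q v (f \o i).
Proof.
move=> sf; set h : 'rV[R]_m -> 'rV[R]_n := chart N (i q) \o i \o param M q.
have hq : h (chart M q q) = chart N (i q) (i q).
  by rewrite /h /= chartK//; exact: mem_dom.
have sc k : smooth_at q (coord (i q) k \o i).
  by apply: smooth_i.2; apply: smooth_at_coord; exact: mem_dom.
have fh : \forall x \near chart M q q,
    ((f \o param N (i q)) \o h) x = ((f \o i) \o param M q) x.
  have := near_param (mem_dom q) (near_comp (dom_near (mem_dom (i q)))).
  by apply: filterS => x /= ix; rewrite chartK.
rewrite [RHS]/dir -(near_eq_derive _ fh) derive_comp.
- rewrite /dir derive_basis; last exact: smooth_near_differentiable.
  rewrite hq; apply: eq_bigr => k _; congr (_ * _).
  rewrite mxE [RHS]derive_basis; last exact: (smooth_near_differentiable (sc k)).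
  by apply: eq_bigr => j _; rewrite mxE.
- by move=> k; exact: (smooth_near_differentiable (sc k)).
- by rewrite hq; exact: smooth_near_differentiable.
Qed.

Lemma smooth_along_eq {p s t} : (\forall q \near p, s q = t q) ->
  smooth_along i p s -> smooth_along i p t.
Proof.
move=> st ss f /ss; apply: smooth_at_eq.
by apply: filterS st => q ->.
Qed.

Lemma near_smooth_comp {p} {f : N -> R} : smooth_at (i p) f ->
  \forall q \near p, smooth_at (i q) f.
Proof. by move=> /smooth_at_near; exact: near_comp. Qed.

Lemma smooth_along0 p : smooth_along i p (fun=> 0).
Proof.
move=> f sf; apply: smooth_at_eq (smooth_at_cst p 0).
by apply: nearW => q; rewrite /dir derive0.
Qed.

Lemma smooth_along_lin {p f s t} : smooth_at p f -> smooth_along i p s ->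
  smooth_along i p t -> smooth_along i p (fun q => f q *: s q + t q).
Proof.
move=> sf ss st g sg.
apply: smooth_at_eq (smooth_atD (smooth_atM sf (ss g sg)) (st g sg)).
by apply: filterS (near_smooth_comp sg) => q sgq; rewrite dir_linear.
Qed.

Lemma smooth_alongZ {p f s} : smooth_at p f -> smooth_along i p s ->
  smooth_along i p (fun q => f q *: s q).
Proof.
move=> sf ss; apply: (smooth_along_eq _ (smooth_along_lin sf ss (smooth_along0 p))).
by apply: nearW => q; rewrite addr0.
Qed.

Lemma smooth_alongD {p s t} : smooth_along i p s -> smooth_along i p t ->
  smooth_along i p (fun q => s q + t q).
Proof.
move=> ss st; apply: (smooth_along_eq _ (smooth_along_lin (smooth_at_cst p 1) ss st)).
by apply: nearW => q; rewrite scale1r.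
Qed.

Lemma smooth_along_sum {p} {I : Type} (r : seq I) {F : I -> M -> 'rV[R]_n} :
  (forall k, smooth_along i p (F k)) ->
  smooth_along i p (fun q => \sum_(k <- r) F k q).
Proof.
move=> sF; elim: r => [|k r IH].
  by under eq_fun do rewrite big_nil; exact: smooth_along0.
by under eq_fun do rewrite big_cons; exact: smooth_alongD.
Qed.

Lemma smooth_along_comp {p} {Z : N -> 'rV[R]_n} : smooth_vf (i p) Z ->
  smooth_along i p (Z \o i).
Proof. by move=> sZ f /sZ/(smooth_i.2 p). Qed.

Lemma smooth_along_differential {p} {X : M -> 'rV[R]_m} : smooth_vf p X ->
  smooth_along i p (fun q => X q *m differential i q).
Proof.
move=> sX f sf; apply: smooth_at_eq (sX _ (smooth_i.2 p f sf)).
by apply: filterS (near_smooth_comp sf) => q sfq; rewrite dir_differential.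
Qed.

Lemma dom_comp_near p : \forall q \near p, dom (i p) (i q).
Proof. exact: near_comp (dom_near (mem_dom (i p))). Qed.

Definition comps p s (k : 'I_n) q : R := dir (i q) (s q) (coord (i p) k).

Definition frame p (k : 'I_n) := cfield (i p) (delta_mx ord0 k).

(** A section along [i] need not come from a field on [N], but the frame does. This expansion
    transfers to sections the properties known for fields on [N]. *)
Lemma frame_expansion p s :
  \forall q \near p, s q = \sum_k comps p s k q *: frame p k (i q).
Proof. by apply: filterS (dom_comp_near p) => q; exact: cfield_frame. Qed.

Lemma smooth_comps {p s} k : smooth_along i p s -> smooth_at p (comps p s k).
Proof. by apply; apply: smooth_at_coord; exact: mem_dom. Qed.

Lemma smooth_frame p k : smooth_vf (i p) (frame p k).
Proof. by apply: smooth_cfield; exact: mem_dom. Qed.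

(** The definition quantifies over all test functions, with no common neighbourhood. One is found
    from the finitely many coefficients of [s] in a frame around [i p]. *)
Lemma smooth_along_near {p s} : smooth_along i p s ->
  \forall q \near p, smooth_along i q s.
Proof.
move=> ss.
have n1 : \forall q \near p, forall k, smooth_at q (comps p s k).
  by apply: filter_forall => k; apply: smooth_at_near; exact: smooth_comps.
have n2 := near_near (frame_expansion p s).
have n3 := dom_comp_near p.
near=> q; apply: (@smooth_along_eq q (fun q => \sum_k comps p s k q *: frame p k (i q))).
  suff : \forall z \near q, s z = \sum_k comps p s k z *: frame p k (i z).
    by apply: filterS => z ->.
  by near: q.
apply: smooth_along_sum => k; apply: smooth_alongZ; first by move: k; near: q.
by apply: (@smooth_along_comp q (frame p k)); apply: smooth_cfield; near: q.
Unshelve. all: by end_near. Qed.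

Lemma smooth_along_endo {p s} {J : N -> 'M[R]_n} : smooth_endo J ->
  smooth_along i p s -> smooth_along i p (fun q => s q *m J (i q)).
Proof.
move=> sJ ss.
apply: (@smooth_along_eq p (fun q => \sum_k comps p s k q *: (frame p k (i q) *m J (i q)))).
  apply: filterS (frame_expansion p s) => q ->.
  by rewrite mulmx_suml; apply: eq_bigr => k _; rewrite scalemxAl.
apply: smooth_along_sum => k; apply: smooth_alongZ; first exact: smooth_comps.
exact: (smooth_along_comp (sJ _ _ (smooth_frame p k))).
Qed.

Lemma smooth_along_ip {p s t} {g : N -> 'M[R]_n} :
  (forall y X Y, smooth_vf y X -> smooth_vf y Y ->
     smooth_at y (fun z => ip (g z) (X z) (Y z))) ->
  smooth_along i p s -> smooth_along i p t ->
  smooth_at p (fun q => ip (g (i q)) (s q) (t q)).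
Proof.
move=> sg ss st.
apply: (@smooth_at_eq _ _ _ _ (fun q => \sum_k \sum_l comps p s k q * (comps p t l q *
    ip (g (i q)) (frame p k (i q)) (frame p l (i q))))).
  apply: filterS2 (frame_expansion p s) (frame_expansion p t) => q sq tq.
  rewrite [in RHS]sq [in RHS]tq /ip !mulmx_suml summxE; apply: eq_bigr => k _.
  rewrite linear_sum/= mulmx_sumr summxE; apply: eq_bigr => l _.
  by rewrite linearZ/= -!scalemxAl -scalemxAr !mxE.
apply: smooth_at_sum => k; apply: smooth_at_sum => l.
apply: smooth_atM; first exact: smooth_comps.
apply: smooth_atM; first exact: smooth_comps.
apply: (smooth_i.2 p (fun z => ip (g z) (frame p k z) (frame p l z))).
by apply: sg; exact: smooth_frame.
Qed.

(** * Linearity and locality of a connection along a map *)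

Section connection.
Context (D : connection_along i).

Lemma cov_lincomb p {I : finType} (c : I -> R) (e : I -> 'rV[R]_m) {s} :
  smooth_along i p s ->
  D p (\sum_k c k *: e k) s = \sum_k c k *: D p (e k) s.
Proof.
by move=> ss; apply: (linear_lincomb c e (f := fun v => D p v s)) => a u v;
  exact: cov_linear.
Qed.

Lemma cov0 p v : D p v (fun=> 0) = 0.
Proof.
have /eqP := cov_add D v (smooth_along0 p) (smooth_along0 p).
have -> : (fun q : M => 0 + 0 : 'rV[R]_n) = fun=> 0.
  by apply/funext => q; rewrite addr0.
by rewrite addrC -subr_eq subrr => /eqP.
Qed.

Lemma covB {p} v {s t} : smooth_along i p s -> smooth_along i p t ->
  D p v (fun q => s q - t q) = D p v s - D p v t.
Proof.
move=> ss st.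
have sN : smooth_along i p (fun q => (-1) *: t q).
  by apply: smooth_alongZ => //; exact: smooth_at_cst.
have -> : (fun q => s q - t q) = fun q => s q + (-1) *: t q.
  by apply/funext => q; rewrite scaleN1r.
rewrite cov_add// (cov_leibniz D v (smooth_at_cst p (-1)) st).
by rewrite dir_cst scale0r add0r scaleN1r.
Qed.

(* A field that vanishes near [p] is its product with a function that vanishes
   near [p], the indicator function of its support. *)
Lemma cov_eq {p} v {s t} : (\forall q \near p, s q = t q) ->
  smooth_along i p s -> D p v s = D p v t.
Proof.
move=> st ss; have st' := smooth_along_eq st ss.
apply/eqP; rewrite -subr_eq0 -covB//; apply/eqP.
pose f q : R := if s q == t q then 0 else 1.
have f0 : \forall q \near p, 0 = f q by apply: filterS st => q; rewrite /f => ->; rewrite eqxx.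
have sf : smooth_at p f by apply: smooth_at_eq f0 (smooth_at_cst p 0).
have sst : smooth_along i p (fun q => s q - t q).
  by apply: (smooth_along_eq _ (smooth_along0 p)); apply: filterS st => q ->; rewrite subrr.
have -> : (fun q => s q - t q) = fun q => f q *: (s q - t q).
  apply/funext => q; rewrite /f; case: eqP => [->|_]; last by rewrite scale1r.
  by rewrite subrr scaler0.
rewrite cov_leibniz// -(dir_eq v f0) dir_cst -(nbhs_singleton f0).
by rewrite !scale0r addr0.
Qed.

Lemma cov_sum {p} v {I : Type} (r : seq I) {F : I -> M -> 'rV[R]_n} :
  (forall k, smooth_along i p (F k)) ->
  D p v (fun q => \sum_(k <- r) F k q) = \sum_(k <- r) D p v (F k).
Proof.
move=> sF; elim: r => [|k r IH].
  by under eq_fun do rewrite big_nil; rewrite cov0 big_nil.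
rewrite big_cons -IH -cov_add//; last exact: smooth_along_sum.
by congr (D p v _); apply/funext => q; rewrite big_cons.
Qed.

Lemma cov_lincomb_sections {p} v {I : finType} {f : I -> M -> R} {F : I -> M -> 'rV[R]_n} :
  (forall k, smooth_at p (f k)) -> (forall k, smooth_along i p (F k)) ->
  D p v (fun q => \sum_k f k q *: F k q)
    = \sum_k dir p v (f k) *: F k p + \sum_k f k p *: D p v (F k).
Proof.
move=> sf sF; rewrite cov_sum => [|k]; last exact: smooth_alongZ.
by rewrite -big_split; apply: eq_bigr => k _; rewrite cov_leibniz.
Qed.

End connection.

End sections_along.
Set Implicit Arguments.

(** * Curvature of a pullback connection *)

Section pullback.
Unset Implicit Arguments.
Context {R : realType} {m n : nat} {M : manifold R m} {N : manifold R n}.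
Context {i : M -> N} (smooth_i : smooth_map i).
Context {nabla : connection N} {D : connection_along i}.
Context (pullbackD : is_pullback nabla D).
Implicit Types (p q : M) (s t : M -> 'rV[R]_n) (f : M -> R).
Implicit Types (u v w : 'rV[R]_m).

Lemma smooth_id (L : manifold R n) : smooth_map (@id L).
Proof. by split=> // x; exact: cvg_id. Qed.

(** On the frame this is the parallelism of [J] on [N], through the pullback property; the Leibniz
    rule extends it to all sections, [J] acting linearly on the coefficients' terms. *)
Lemma pullback_parallel_endo {J : N -> 'M[R]_n} {p} v {s} :
  smooth_endo J -> parallel_endo nabla J -> smooth_along i p s ->
  D p v (fun q => s q *m J (i q)) = D p v s *m J (i p).
Proof.
move=> sJ parJ ss.
have sE k : smooth_along i p (frame (i:=i) p k \o i).
  exact: (smooth_along_comp smooth_i (smooth_frame p k)).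
have sEJ k : smooth_along i p (fun q => frame (i:=i) p k (i q) *m J (i q)).
  exact: (smooth_along_endo smooth_i sJ (sE k)).
have sc k : smooth_at p (comps (i:=i) p s k) by exact: smooth_comps.
rewrite (cov_eq smooth_i D v (frame_expansion smooth_i p s) ss).
rewrite -(cov_eq smooth_i D v (s := fun q => \sum_k comps (i:=i) p s k q
     *: (frame (i:=i) p k (i q) *m J (i q)))); first last.
- exact: (smooth_along_sum smooth_i _ (fun k => smooth_alongZ smooth_i (sc k) (sEJ k))).
- apply: filterS (frame_expansion smooth_i p s) => q ->.
  by rewrite mulmx_suml; apply: eq_bigr => k _; rewrite scalemxAl.
rewrite (cov_lincomb_sections smooth_i D v sc sEJ).
rewrite (cov_lincomb_sections smooth_i D v sc sE) mulmxDl !mulmx_suml.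
congr (_ + _); apply: eq_bigr => k _; rewrite -scalemxAl//; congr (_ *: _).
rewrite (pullbackD _ _ (fun z => frame p k z *m J z)); last exact/sJ/smooth_frame.
rewrite pullbackD; last exact: smooth_frame.
by apply/eqP; rewrite -subr_eq0; apply/eqP; apply: parJ; exact: smooth_frame.
Qed.

(* For fields with vanishing bracket at [p], such as coordinate fields, this is
   the curvature of [D] at [p]. *)
Definition cov_commutator p u w s : 'rV[R]_n :=
  D p u (fun q => D q (cfield p w q) s) - D p w (fun q => D q (cfield p u q) s).

Lemma smooth_cov_cfield {p} u {s} : smooth_along i p s ->
  smooth_along i p (fun q => D q (cfield p u q) s).
Proof.
by move=> ss; apply: cov_smooth => //; apply: smooth_cfield; exact: mem_dom.
Qed.

Lemma cov_commutator_eq p u w {s t} : (\forall q \near p, s q = t q) ->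
  smooth_along i p s -> cov_commutator p u w s = cov_commutator p u w t.
Proof.
move=> st ss; have H v z : D p v (fun q => D q (cfield p z q) s)
    = D p v (fun q => D q (cfield p z q) t).
  apply: (cov_eq smooth_i); last exact: smooth_cov_cfield.
  apply: filterS2 (near_near st) (smooth_along_near smooth_i ss) => q stq sq.
  exact: (cov_eq smooth_i).
by rewrite /cov_commutator (H u w) (H w u).
Qed.

(** By the Leibniz rule used twice, the terms with first derivatives of [f] are symmetric in [u] and
    [w], and those with second derivatives are so by [dir_cfield_sym]; all of them cancel. *)
Lemma cov_commutatorZ p u w {f s} : smooth_at p f -> smooth_along i p s ->
  cov_commutator p u w (fun q => f q *: s q) = f p *: cov_commutator p u w s.
Proof.
move=> sf ss; have H v z : D p v (fun q => D q (cfield p z q) (fun q => f q *: s q))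
    = dir p v (fun q => dir q (cfield p z q) f) *: s p
      + (dir p z f *: D p v s + dir p v f *: D p z s)
      + f p *: D p v (fun q => D q (cfield p z q) s).
  have sdf : smooth_at p (fun q => dir q (cfield p z q) f).
    by apply: (smooth_cfield z (mem_dom p)).
  rewrite -(cov_eq smooth_i D v (s := fun q =>
     dir q (cfield p z q) f *: s q + f q *: D q (cfield p z q) s)); first last.
  - exact: (smooth_alongD smooth_i (smooth_alongZ smooth_i sdf ss)
      (smooth_alongZ smooth_i sf (smooth_cov_cfield z ss))).
  - apply: filterS2 (smooth_at_near sf) (smooth_along_near smooth_i ss) => q fq sq.
    by rewrite cov_leibniz.
  have sDs := smooth_cov_cfield z ss.
  rewrite cov_add; [|exact: (smooth_alongZ smooth_i)|exact: (smooth_alongZ smooth_i)].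
  by rewrite !cov_leibniz// cfield_id !addrA.
rewrite /cov_commutator (H u w) (H w u) (dir_cfield_sym u w sf).
rewrite [dir p u f *: _ + _]addrC scalerBr opprD addrACA.
by rewrite subrr add0r.
Qed.

Lemma cov_commutator_sum p u w {I : Type} (r : seq I) {F : I -> M -> 'rV[R]_n} :
  (forall k, smooth_along i p (F k)) ->
  cov_commutator p u w (fun q => \sum_(k <- r) F k q)
    = \sum_(k <- r) cov_commutator p u w (F k).
Proof.
move=> sF; have H v z : D p v (fun q => D q (cfield p z q) (fun q => \sum_(k <- r) F k q))
    = \sum_(k <- r) D p v (fun q => D q (cfield p z q) (F k)).
  rewrite -(cov_sum smooth_i) => [|k]; last exact: smooth_cov_cfield.
  apply: (cov_eq smooth_i); last first.
    by apply: smooth_cov_cfield; exact: (smooth_along_sum smooth_i).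
  elim: r => [|k r IH].
    by apply: nearW => q; under eq_fun do rewrite big_nil; rewrite cov0 ?big_nil.
  have nr := smooth_along_near smooth_i (smooth_along_sum smooth_i r sF).
  have nk := smooth_along_near smooth_i (sF k).
  apply: filterS3 IH nr nk => q IHq srq skq; under eq_fun do rewrite big_cons.
  by rewrite (cov_add D _ skq srq) big_cons IHq.
by rewrite /cov_commutator (H u w) (H w u) sumrB.
Qed.

(** Writing the derivative of [Z \o i] through the coordinates of [i] and differentiating again, the
    second derivatives of these coordinates cancel. What remains are commutators of derivatives
    along frame fields, which are curvatures as the frame fields have zero bracket at [i p]. *)
Lemma cov_commutator_comp p u w {Z : N -> 'rV[R]_n} : smooth_vf (i p) Z ->
  cov_commutator p u w (Z \o i)
  = \sum_b \sum_c (dir p w (coord (i p) b \o i) * dir p u (coord (i p) c \o i))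
      *: curvature nabla (frame (i:=i) p c) (frame (i:=i) p b) Z (i p).
Proof.
move=> sZ; pose E := frame (i:=i) p.
pose h k : M -> R := coord (i p) k \o i.
have sh k : smooth_at p (h k).
  by apply: smooth_i.2; apply: smooth_at_coord; exact: mem_dom.
have sE k : smooth_vf (i p) (E k) by exact: smooth_frame.
have sEZ k : smooth_vf (i p) (fun z => nabla z (E k z) Z) by exact: (cov_smooth nabla (sE k) sZ).
have covE v (Y : N -> 'rV[R]_n) : smooth_vf (i p) Y ->
    D p v (Y \o i) = \sum_c dir p v (h c) *: nabla (i p) (E c (i p)) Y.
  move=> sY; rewrite pullbackD// -(cov_lincomb nabla)//; congr (nabla _ _ _).
  rewrite [LHS](cfield_frame _ (mem_dom (i p))); apply: eq_bigr => k _.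
  by rewrite dir_differential//; apply: smooth_at_coord; exact: mem_dom.
have H v z : D p v (fun q => D q (cfield p z q) (Z \o i))
    = \sum_b dir p v (fun q => dir q (cfield p z q) (h b)) *: nabla (i p) (E b (i p)) Z
     + \sum_b \sum_c (dir p z (h b) * dir p v (h c)) *:
        nabla (i p) (E c (i p)) (fun y => nabla y (E b y) Z).
  have sdh b : smooth_at p (fun q => dir q (cfield p z q) (h b)).
    by apply: (smooth_cfield z (mem_dom p)).
  rewrite -(cov_eq smooth_i D v (s := fun q =>
     \sum_b dir q (cfield p z q) (h b) *: nabla (i q) (E b (i q)) Z)); first last.
  - exact: (smooth_along_sum smooth_i _ (fun b =>
      smooth_alongZ smooth_i (sdh b) (smooth_along_comp smooth_i (sEZ b)))).
  - apply: filterS2 (dom_comp_near smooth_i p)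
      (near_comp smooth_i (smooth_along_near (smooth_id _) sZ)) => q dq sZq.
    rewrite pullbackD// -(cov_lincomb nabla)//; congr (nabla _ _ _).
    rewrite [RHS](cfield_frame _ dq); apply: eq_bigr => k _.
    by rewrite dir_differential//; apply: smooth_at_coord.
  rewrite (cov_lincomb_sections smooth_i)//.
    congr (_ + _); apply: eq_bigr => b _; rewrite cfield_id.
    rewrite (covE v _ (sEZ b)) scaler_sumr.
    by apply: eq_bigr => c _; rewrite scalerA.
  by move=> b; exact: (smooth_along_comp smooth_i (sEZ b)).
rewrite /cov_commutator (H u w) (H w u).
under [X in X + _ - _]eq_bigr do rewrite dir_cfield_sym//.
(* Exchanging the summation indices in the subtracted sum gives both double sums the same
   coefficients. *)
rewrite opprD addrACA subrr add0r [X in _ - X]exchange_big -sumrB/=.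
apply: eq_bigr => b _; rewrite -sumrB; apply: eq_bigr => c _.
rewrite [X in _ - X *: _]mulrC -scalerBr; congr (_ *: _).
rewrite /curvature bracket_cfield.
have -> : nabla (i p) 0 Z = 0.
  have := cov_linear nabla (-1) 0 0 sZ.
  by rewrite scaler0 addr0 scaleN1r addNr.
by rewrite subr0.
Qed.

(* [K] stands for the curvature tensor of [nabla] at [i p]. *)
Lemma cov_commutatorE p u w {s} (K : 'rV[R]_n -> 'rV[R]_n -> 'rV[R]_n -> 'rV[R]_n) :
  (forall y z (a : R) x x', K (a *: x + x') y z = a *: K x y z + K x' y z) ->
  (forall x z (a : R) y y', K x (a *: y + y') z = a *: K x y z + K x y' z) ->
  (forall x y (a : R) z z', K x y (a *: z + z') = a *: K x y z + K x y z') ->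
  (forall X Y Z, smooth_vf (i p) X -> smooth_vf (i p) Y -> smooth_vf (i p) Z ->
    curvature nabla X Y Z (i p) = K (X (i p)) (Y (i p)) (Z (i p))) ->
  smooth_along i p s ->
  cov_commutator p u w s
    = K (u *m differential i p) (w *m differential i p) (s p).
Proof.
move=> Kl Km Kr curvK ss.
have Kcomp Z : smooth_vf (i p) Z -> cov_commutator p u w (Z \o i)
    = K (u *m differential i p) (w *m differential i p) (Z (i p)).
  move=> sZ; rewrite cov_commutator_comp//.
  have dE v : v *m differential i p
      = \sum_c dir p v (coord (i p) c \o i) *: frame (i:=i) p c (i p).
    rewrite [LHS](cfield_frame _ (mem_dom (i p))); apply: eq_bigr => k _.
    by rewrite dir_differential//; apply: smooth_at_coord; exact: mem_dom.
  rewrite [w *m _]dE (linear_lincomb (f := fun y => K _ y _)) => [|a y y']; last exact: Km.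
  apply: eq_bigr => b _.
  rewrite [u *m _]dE (linear_lincomb (f := fun y => K y _ _)) => [|a y y']; last exact: Kl.
  rewrite scaler_sumr; apply: eq_bigr => c _.
  by rewrite (curvK _ _ _ (smooth_frame p c) (smooth_frame p b) sZ) scalerA.
have sE k : smooth_along i p (frame (i:=i) p k \o i).
  exact: (smooth_along_comp smooth_i (smooth_frame p k)).
have sc k : smooth_at p (comps (i:=i) p s k) by exact: smooth_comps.
rewrite (cov_commutator_eq _ _ _ (frame_expansion smooth_i p s) ss).
rewrite [in RHS](nbhs_singleton (frame_expansion smooth_i p s)).
rewrite (linear_lincomb (f := fun z => K _ _ z)) => [|a z z']; last exact: Kr.
have sF k := smooth_alongZ smooth_i (sc k) (sE k).
rewrite (cov_commutator_sum p u w _ sF); apply: eq_bigr => k _.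
by rewrite (cov_commutatorZ p u w (sc k) (sE k)) (Kcomp _ (smooth_frame p k)).
Qed.

End pullback.
Set Implicit Arguments.

(** * Tangential hypersurfaces *)

Section ip_theory.
Variables (R : realType) (n : nat) (G : 'M[R]_n).
Implicit Types (u v w : 'rV[R]_n) (a : R).

Lemma ipDl u v w : ip G (u + v) w = ip G u w + ip G v w.
Proof. by rewrite /ip !mulmxDl mxE. Qed.

Lemma ipZl a u w : ip G (a *: u) w = a * ip G u w.
Proof. by rewrite /ip -!scalemxAl mxE. Qed.

Lemma ipDr u v w : ip G u (v + w) = ip G u v + ip G u w.
Proof. by rewrite /ip linearD/= mulmxDr mxE. Qed.

Lemma ipZr a u w : ip G u (a *: w) = a * ip G u w.
Proof. by rewrite /ip linearZ/= -scalemxAr mxE. Qed.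

Lemma ipNl u w : ip G (- u) w = - ip G u w.
Proof. by rewrite -scaleN1r ipZl mulN1r. Qed.

Lemma ipNr u w : ip G u (- w) = - ip G u w.
Proof. by rewrite -scaleN1r ipZr mulN1r. Qed.

Lemma ip0l w : ip G 0 w = 0.
Proof. by rewrite /ip !mul0mx mxE. Qed.

Lemma ip_sym u v : G^T = G -> ip G u v = ip G v u.
Proof.
move=> sG; rewrite /ip -[in LHS](trmxK (u *m G *m v^T)) mxE.
by rewrite !trmx_mul trmxK sG mulmxA.
Qed.

End ip_theory.

(** Taking determinants, the square of [\det J] is (-1)^n, which must be nonnegative. *)
Lemma square_opp1_odd (R : realFieldType) (n : nat) (J : 'M[R]_n) :
  J *m J = - 1%:M -> ~~ odd n.
Proof.
move=> JJ; apply/negP => odd_n.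
have := sqr_ge0 (\det J); rewrite expr2 -det_mulmx JJ.
by rewrite -scaleN1r detZ det1 mulr1 -signr_odd odd_n expr1 oppr_ge0 ler10.
Qed.

Section hypersurface.
Variables (R : realType) (m : nat) (H : hermite_like R m.+1).
Variable M : tangential_hypersurface H.
Implicit Types (p q : M) (u v w : 'rV[R]_m).

Local Notation G p := (metric H (emb (t:=M) p)).
Local Notation J p := (cpx H (emb (t:=M) p)).
Local Notation Jd p := (cpx_dual H (emb (t:=M) p)).
Local Notation N := (@normal _ _ _ M).

Lemma ip_hmetric p v w : ip (hmetric p) v w = ip (G p) (push p v) (push p w).
Proof. by rewrite /ip /push /hmetric /induced_metric trmx_mul !mulmxA. Qed.

Lemma G_sym p : (G p)^T = G p.
Proof. exact: (Defs.metric_sym (metric_semi_riemannian H) (emb p)). Qed.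

Lemma hmetric_sym p v w : ip (hmetric p) v w = ip (hmetric p) w v.
Proof. by rewrite !ip_hmetric; apply: ip_sym; exact: G_sym. Qed.

Lemma cpxK p (x : 'rV[R]_m.+1) : x *m J p *m J p = - x.
Proof. by rewrite -mulmxA cpx_square mulmxN mulmx1. Qed.

Lemma cpx_dualK p (x : 'rV[R]_m.+1) : x *m Jd p *m Jd p = - x.
Proof. by rewrite -mulmxA cpx_dual_square mulmxN mulmx1. Qed.

(** The adjunction moves [J] from one side to [J*] on the other, and the square of [J*] is -1. So
    [eps] is the constant sign of the unit normal. *)
Lemma epsE p : eps M p = ip (G p) (N p) (N p).
Proof.
rewrite /eps ip_hmetric xiE xi_dualE ipNl ipNr opprK cpx_adjoint cpx_dualK.
by rewrite ipNr opprK.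
Qed.

Lemma eps_cst : exists2 e : R, e * e = 1 & forall p, eps M p = e.
Proof.
case: (@normal_unit _ _ _ M) => NN.
  by exists 1; [rewrite mulr1|move=> p; rewrite epsE].
by exists (-1); [rewrite mulrNN mulr1|move=> p; rewrite epsE].
Qed.

Lemma push_inj p : injective (push p).
Proof.
by move=> u v; exact: (row_free_inj (emb_immersion p)).
Qed.

Lemma push0 p : push p 0 = 0. Proof. exact: mul0mx. Qed.

(** Since [xi = - J N], [J xi] is [N], whose tangential part is zero; the normal coefficient is the
    square of [eps], that is 1. *)
Lemma xi_phi p : xi M p *m phi M p = 0.
Proof.
apply: (@push_inj p); rewrite push0.
have := phiE p (xi M p); rewrite xiE mulNmx cpxK opprK.
have -> : eps M p * eta_dual M p (xi M p) = 1.
  by rewrite (_ : eta_dual M p _ = eps M p)//; have [e e2 ->] := eps_cst.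
by rewrite scale1r => /(congr1 (fun z => z - N p)); rewrite addrK subrr.
Qed.

(** * Parallelism of the plane spanned by [N] and [J N] *)

Hypothesis kaehlerH : kaehler_like H.
Hypothesis phi_parallel : parallel_endo (hconn M) (phi M).

Let smooth_emb : smooth_map (emb (t:=M)) := emb_smooth M.

Lemma along_cpx p v s : smooth_along (emb (t:=M)) p s ->
  along M p v (fun q => s q *m J q) = along M p v s *m J p.
Proof.
move=> ss; have sJ := @cpx_smooth _ _ H.
exact: (pullback_parallel_endo smooth_emb (@alongP _ _ _ M) v sJ kaehlerH ss).
Qed.

(* Since [phi] is parallel and [xi] is in its kernel, applying [J] to the Gauss
   formula for [xi = - J N] leaves no component outside of [N] and [J N]. *)
Lemma along_normal p v : exists a b : R,
  along M p v N = a *: (N p *m J p) + b *: N p.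
Proof.
have sxi : smooth_along (emb (t:=M)) p (fun q => push q (xi M q)).
  by apply: (smooth_along_differential smooth_emb); exact: xi_smooth.
have NE : (fun q => push q (xi M q) *m J q) = N.
  by apply/funext => q; rewrite xiE mulNmx cpxK opprK.
rewrite -[in along _ _ _ _]NE along_cpx// gauss; last exact: xi_smooth.
have sx : smooth_vf p (xi M) by exact: xi_smooth.
have := phi_parallel v sx; rewrite /cov_endo.
have -> : (fun q => xi M q *m phi M q) = fun=> 0 by apply/funext => q; exact: xi_phi.
rewrite cov0 sub0r => /eqP; rewrite oppr_eq0 => /eqP E.
rewrite mulmxDl phiE E push0 add0r -scalemxAl addrC.
by do 2 eexists.
Qed.

(** With the next two pairings, this lets products with [J* N] and [N] read off the coefficients of
    a combination of [J N] and [N]. *)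
Lemma normal_cpx_dual p : ip (G p) (N p) (N p *m Jd p) = 0.
Proof.
rewrite (ip_sym _ _ (G_sym p)) -[N p *m _]opprK -xi_dualE ipNl.
by rewrite normal_orthogonal oppr0.
Qed.

Lemma normal_cpx p : ip (G p) (N p *m J p) (N p) = 0.
Proof. by rewrite -[N p *m _]opprK -xiE ipNl normal_orthogonal oppr0. Qed.

Lemma ip_cpx_cpx_dual p : ip (G p) (N p *m J p) (N p *m Jd p) = eps M p.
Proof. by rewrite cpx_adjoint cpx_dualK ipNr opprK epsE. Qed.

Lemma smooth_normal_cpx p : smooth_along (emb (t:=M)) p (fun q => N q *m J q).
Proof.
apply: (smooth_along_endo smooth_emb); first exact: cpx_smooth.
exact: normal_smooth.
Qed.

Lemma cov_commutator_normal p u w : exists a b : R,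
  cov_commutator (D := along M) p u w N = a *: (N p *m J p) + b *: N p.
Proof.
have sN : smooth_along (emb (t:=M)) p N by exact: normal_smooth.
have sJN : smooth_along (emb (t:=M)) p (fun q => N q *m J q).
  exact: smooth_normal_cpx.
have sJdN : smooth_along (emb (t:=M)) p (fun q => N q *m Jd q).
  by apply: (smooth_along_endo smooth_emb); [exact: cpx_dual_smooth|].
have [e e2 eE] := eps_cst.
have Hz v z : exists a b : R,
    along M p v (fun q => along M q (cfield p z q) N) = a *: (N p *m J p) + b *: N p.
  pose s q := along M q (cfield p z q) N.
  have ss : smooth_along (emb (t:=M)) p s.
    by apply: cov_smooth => //; apply: smooth_cfield; exact: mem_dom.
  (* [along_normal] gives coefficients point by point. Pairing with [J* N] and [N] makes them smooth
     functions, as a second differentiation requires; the factor [e] is its own inverse and cancels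
     [eps]. *)
  pose a q := e * ip (G q) (s q) (N q *m Jd q).
  pose b q := e * ip (G q) (s q) (N q).
  have sG := metric_smooth (metric_semi_riemannian H).
  have sa : smooth_at p a.
    by apply: smooth_atM; [exact: smooth_at_cst|exact: (smooth_along_ip smooth_emb)].
  have sb : smooth_at p b.
    by apply: smooth_atM; [exact: smooth_at_cst|exact: (smooth_along_ip smooth_emb)].
  have -> : (fun q => along M q (cfield p z q) N)
      = fun q => a q *: (N q *m J q) + b q *: N q.
    apply/funext => q; rewrite /a /b /s.
    have [a' [b' ->]] := along_normal q (cfield p z q).
    rewrite !ipDl !ipZl normal_cpx_dual ip_cpx_cpx_dual normal_cpx -epsE eE.
    by rewrite !mulr0 addr0 add0r mulrCA e2 mulrCA e2 !mulr1.
  rewrite cov_add; [|exact: (smooth_alongZ smooth_emb)|exact: (smooth_alongZ smooth_emb)].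
  rewrite !cov_leibniz// along_cpx//.
  have [a' [b' ->]] := along_normal p v.
  rewrite mulmxDl -!scalemxAl cpxK.
  (* Leibniz rule, with derivative [a' J N + b' N] of [N] and hence [b' J N - a' N] of [J N]. *)
  exists (dir p v a + a p * b' + b p * a'), (dir p v b + b p * b' - a p * a').
  move: (N p *m J p) (N p) (a p) (b p) => x y ap bp.
  by apply/rowP => k; rewrite !mxE; ring.
have [a [b E]] := Hz u w; have [a' [b' E']] := Hz w u.
exists (a - a'), (b - b'); rewrite /cov_commutator E E'.
by rewrite !scalerBl opprD addrACA.
Qed.

(** * The curvature formula applied to the normal field *)

Variable c : R.
Hypothesis curvH : constant_holomorphic_curvature H c.

Let K p (x y z : 'rV[R]_m.+1) : 'rV[R]_m.+1 :=
  let g := ip (G p) in let J x' := x' *m cpx H (emb (t:=M) p) in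
  (c / 4) *: (g y z *: x - g x z *: y - g y (J z) *: J x + g x (J z) *: J y
     + g x (J y) *: J z - g (J x) y *: J z).

Lemma cov_commutator_curvature p u w s : smooth_along (emb (t:=M)) p s ->
  cov_commutator (D := along M) p u w s = K p (push p u) (push p w) (s p).
Proof.
apply: (cov_commutatorE smooth_emb (@alongP _ _ _ M)); last first.
- by move=> X Y Z sX sY sZ; rewrite curvH.
- move=> x y a z z'; rewrite /K /= !mulmxDl -!scalemxAl !ipDr !ipZr.
  rewrite !scalerDl !scalerDr.
  by apply/rowP => k; rewrite !mxE; ring.
- move=> x z a y y'; rewrite /K /= !mulmxDl -!scalemxAl !ipDl !ipDr !ipZl !ipZr.
  by apply/rowP => k; rewrite !mxE; ring.
- move=> y z a x x'; rewrite /K /= !mulmxDl -!scalemxAl !ipDl !ipZl.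
  by apply/rowP => k; rewrite !mxE; ring.
Qed.

(** For [Z = N] the terms in g(Y, N) and g(X, N) vanish, so [eta w *: J u - eta u *: J w] is a
    combination of [J N] and [N]. Applying [J] gives one of [N] and [xi], whose [N] part is zero
    because the left side is tangent. *)
Lemma eta_swap_span p u w : c != 0 -> exists b : R,
  eta M p w *: u - eta M p u *: w = b *: xi M p.
Proof.
move=> c0.
have [a [b E]] := cov_commutator_normal p u w.
move: E; have sN : smooth_along (emb (t:=M)) p N by exact: normal_smooth.
rewrite (cov_commutator_curvature u w sN) /K /=.
rewrite !normal_orthogonal !scale0r.
have etaE v : ip (G p) (push p v) (N p *m J p) = - eta M p v.
  by rewrite /eta ip_hmetric xiE ipNr opprK.
rewrite !etaE.
set k1 := ip _ _ _; set k2 := ip _ _ _.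
(* This factor removes [c / 4] and the sign that comes from the square of [J]. *)
move=> /(congr1 (fun z => - (4 / c) *: (z *m J p))).
rewrite -!scalemxAl !(mulmxDl, mulNmx) -!scalemxAl !cpxK !mul0mx => E.
pose al := 4 / c * a + k2 - k1; pose be := 4 / c * b.
have E2 : eta M p w *: push p u - eta M p u *: push p w
    = al *: N p + be *: push p (xi M p).
  rewrite xiE; move: E; rewrite /al /be.
  move: (push p u) (push p w) (N p) (N p *m J p) => U W y x.
  move=> /(congr1 (fun z => z + (k2 - k1) *: y)) E.
  transitivity (al *: y - be *: x).
    apply: etrans (etrans E _).
      by apply/rowP => k; rewrite !mxE; field.
    by apply/rowP => k; rewrite !mxE /al /be; field.
  by rewrite /al /be scalerN.
have al0 : al = 0.
  have [e e2 eE] := eps_cst.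
  have := congr1 (fun z => ip (G p) z (N p)) E2.
  rewrite !(ipDl, ipNl, ipZl) !normal_orthogonal -epsE eE.
  rewrite !mulr0 subr0 addr0 => /esym /(congr1 (fun z => z * e)).
  by rewrite -mulrA e2 mulr1 mul0r.
exists be; apply: (@push_inj p).
move: E2; rewrite al0 scale0r add0r /push => E2.
by rewrite mulmxDl mulNmx -!scalemxAl.
Qed.

Lemma curve_of_c_neq0 p : c != 0 -> m = 1%N.
Proof.
move=> c0.
have m_odd : odd m by have := square_opp1_odd (cpx_square (emb p)); rewrite /= negbK.
have [e e2 eE] := eps_cst.
have e0 : e != 0 by apply: contra_eq_neq e2 => ->; rewrite mul0r eq_sym oner_eq0.
have full : (1%:M <= col_mx (xi_dual M p) (xi M p))%MS.
  apply/rV_subP => u _; have [b E] := eta_swap_span p u (xi_dual M p) c0.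
  have et : eta M p (xi_dual M p) = e by rewrite /eta hmetric_sym -/(eps M p) eE.
  rewrite et in E.
  (* [E], taken with [w = xi*], is solved for [u] by multiplying by [e], whose square is 1. *)
  have -> : u = (e * eta M p u) *: xi_dual M p + (e * b) *: xi M p.
    rewrite -!scalerA -E -scalerDr addrC subrK scalerA e2 scale1r//.
  rewrite -addsmxE; apply: addmx_sub_adds; exact: scalemx_sub.
(* Two rows span the space, so [m] is at most 2, and parity excludes 0 and 2. *)
have := mxrankS full; rewrite mxrank1 => /leq_trans/(_ (rank_leq_row _)).
by case: m m_odd => [|[|[|]]].
Qed.

End hypersurface.

(** * Hypersurfaces of dimension one *)

Lemma formD (R : realType) (n : nat) (t : 'cV[R]_n) (v w : 'rV[R]_n) :
  form t (v + w) = form t v + form t w.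
Proof. by rewrite /form mulmxDl mxE. Qed.

Lemma formZ (R : realType) (n : nat) (t : 'cV[R]_n) (a : R) (v : 'rV[R]_n) :
  form t (a *: v) = a * form t v.
Proof. by rewrite /form -scalemxAl mxE. Qed.

(* Hence the left side of (ii) vanishes on curves. *)
Lemma cov_form_proportional (R : realType) (n : nat) (M : manifold R n)
    (nabla : connection M) (t : M -> 'cV[R]_n) (p : M) (X : M -> 'rV[R]_n)
    (f : M -> R) :
  smooth_form t -> smooth_vf p X -> smooth_at p f ->
  cov_form nabla t p (f p *: X p) X
    = cov_form nabla t p (X p) (fun q => f q *: X q).
Proof.
move=> st sX sf; rewrite /cov_form.
have sfX : smooth_at p (fun q => form (t q) (X q)) by exact: st.
have -> : (fun q => form (t q) (f q *: X q)) = fun q => f q * form (t q) (X q).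
  by apply/funext => q; rewrite formZ.
rewrite (dirM (X p) sf sfX) (cov_leibniz nabla (X p) sf sX) formD !formZ.
have -> : dir p (f p *: X p) (fun q => form (t q) (X q))
    = f p * dir p (X p) (fun q => form (t q) (X q)).
  have := dir_linear (f p) (X p) 0 sfX.
  by rewrite addr0 => ->; rewrite [X in _ + X]derive0 addr0.
have -> : nabla p (f p *: X p) X = f p *: nabla p (X p) X.
  have := cov_linear nabla (f p) (X p) 0 sX.
  rewrite addr0 => ->.
  have := cov_linear nabla (-1) 0 0 sX.
  by rewrite scaler0 addr0 scaleN1r addNr => ->; rewrite addr0.
by rewrite formZ; ring.
Qed.

Lemma curve_cov_form (R : realType) (H : hermite_like R 2)
    (M : tangential_hypersurface H) (eps1 : forall p : M, eps M p = 1) (p : M) :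
  cov_form (hconn M) (theta M) p (xi_dual M p) (xi M)
    - cov_form (hconn M) (theta M) p (xi M p) (xi_dual M)
  = eta M p (xi M p) * eta_dual M p (xi_dual M p) - eps M p.
Proof.
(* The ratio of [xi*] to [xi] is given as a metric product, which equals it because [eps] is 1; its
   smoothness then follows from that of the metric. *)
pose f (q : M) := ip (hmetric q) (xi_dual M q) (xi_dual M q).
have fE q : xi_dual M q = f q *: xi M q.
  have xi0 : xi M q 0 0 != 0.
    apply: contra_eq_neq (eps1 q) => xi0; rewrite /eps.
    have -> : xi M q = 0 by apply/rowP => k; rewrite (ord1 k) xi0 mxE.
    by rewrite ip0l eq_sym oner_eq0.
  pose k := xi_dual M q 0 0 / xi M q 0 0.
  have kE : xi_dual M q = k *: xi M q.
    by apply/rowP => j; rewrite (ord1 j) !mxE divfK.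
  have fk : f q = k by rewrite /f [X in ip _ X _]kE ipZl -/(eps M q) eps1 mulr1.
  by rewrite fk.
have sf : smooth_at p f.
  have sxi : smooth_along (emb (t:=M)) p (fun q => push q (xi_dual M q)).
    by apply: (smooth_along_differential (emb_smooth M)); exact: xi_dual_smooth.
  have -> : f = fun q => ip (metric H (emb q)) (push q (xi_dual M q)) (push q (xi_dual M q)).
    by apply/funext => q; rewrite /f ip_hmetric.
  exact: (smooth_along_ip (emb_smooth M) (metric_smooth (metric_semi_riemannian H)) sxi sxi).
have sxi : smooth_vf p (xi M) by exact: xi_smooth.
have -> : xi_dual M = fun q => f q *: xi M q by apply/funext.
rewrite (cov_form_proportional (hconn M) (@theta_smooth _ _ _ M) sxi sf) subrr.
have := eps1 p; rewrite /eta_dual -fE -/(f p) => e1; rewrite e1.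
move: e1; rewrite /eps fE ipZr mulrC => e1.
by rewrite /eta e1 subrr.
Qed.

(* [curve_spacelike] only bears on curves in surfaces, for which (ii) always
   reads 0 = 1 - eps, so that the claim fails when N is timelike: take R^2
   with metric dx^2 - dy^2, flat connection, J the rotation by pi/2, J* = - J,
   c = 4 (both sides of the curvature equation vanish) and M the x-axis. *)
Theorem theorem4p1 (R : realType) (m : nat) (H : hermite_like R m.+1) (c : R)
    (M : tangential_hypersurface H)
    (kaehlerH : kaehler_like H)
    (curvH : constant_holomorphic_curvature H c)
    (hopfM : hopf M)
    (phi_parallel : parallel_endo (hconn M) (phi M))
    (curve_spacelike : m = 1%N -> forall p : M, eps M p = 1) :
  c = 0 \/
  forall p : M,
    cov_form (hconn M) (theta M) p (xi_dual M p) (xi M)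
      - cov_form (hconn M) (theta M) p (xi M p) (xi_dual M)
    = eta M p (xi M p) * eta_dual M p (xi_dual M p) - eps M p.
Proof.
have [c0|c0] := eqVneq c 0; [by left|right=> p].
have m1 := curve_of_c_neq0 kaehlerH phi_parallel curvH p c0.
subst m; apply: curve_cov_form; exact: curve_spacelike.
Qed.
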